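(* Let $k$ be an algebraically closed field of characteristic $0$, and let $f=(f_1,\ldots,f_n)\colon\mathbb{A}^n_k\to\mathbb{A}^n_k$ be a polynomial morphism. Assume $\mathrm{Jac}(f)\in k^\times$. Then the reduced Bézoutian $\overline{\mathrm{B\acute ez}}(f-q)$ is constant for all $q\in\mathbb{A}^n_k(k)$ if and only if $f$ is invertible.
   Context: Write $\mathbf{x}=(x_1,\ldots,x_n)$, $\mathbf{y}=(y_1,\ldots,y_n)$. A polynomial morphism $f\colon\mathbb{A}^n_k\to\mathbb{A}^n_k$ is given by polynomials $f_1,\ldots,f_n\in k[\mathbf{x}]$; for $q=(q_1,\ldots,q_n)\in k^n$, $f-q$ denotes $(f_1-q_1,\ldots,f_n-q_n)$. $\mathrm{Jac}(f):=\det(\partial f_i/\partial x_j)$. ''Invertible'' means that $f$ has a two-sided inverse that is a polynomial morphism. The (multivariate) Bézoutian of $f$ is the determinant $\mathrm{B\acute ez}(f):=\det(\Delta_{ij})\in k[\mathbf{x},\mathbf{y}]$, where $$\Delta_{ij}=\frac{f_i(y_1,\ldots,y_{j-1},x_j,\ldots,x_n)-f_i(y_1,\ldots,y_j,x_{j+1},\ldots,x_n)}{x_j-y_j}.$$ The reduced Bézoutian $\overline{\mathrm{B\acute ez}}(f)$ is the class of $\mathrm{B\acute ez}(f)$ in $k[\mathbf{x},\mathbf{y}]/(f(\mathbf{x}),f(\mathbf{y}))$, where $(f(\mathbf{x}),f(\mathbf{y}))$ is the ideal generated by $f_1(\mathbf{x}),\ldots,f_n(\mathbf{x}),f_1(\mathbf{y}),\ldots,f_n(\mathbf{y})$.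 Thus $\overline{\mathrm{B\acute ez}}(f-q)$ is the class of $\mathrm{B\acute ez}(f-q)$ in $k[\mathbf{x},\mathbf{y}]/(f(\mathbf{x})-q,f(\mathbf{y})-q)$. For a polynomial ring $R$ over $k$ and an ideal $I\subseteq R$, an element $c\in R/I$ is called constant if (i) $I$ is a proper ideal and $c\in k\subseteq R/I$, or (ii) $I$ is not proper, in which case $c=0$. *)

(* Defs.v *)
From HB Require Import structures.
From mathcomp Require Import all_boot all_order all_algebra.
From mathcomp Require Import generic_quotient ring_quotient.
From mathcomp Require Import mpoly.
From mathcomp Require boolp.

Set Implicit Arguments.
Unset Strict Implicit.
Unset Printing Implicit Defensive.

Import GRing.Theory.
Local Open Scope ring_scope.
Local Open Scope quotient_scope.

Section GeneratedIdeal.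
Variables (R : comNzRingType) (m : nat) (g : m.-tuple R).

Definition genideal : R -> bool := fun p =>
  boolp.asbool (exists a : 'I_m -> R, p = \sum_(i < m) a i * tnth g i).

Lemma genidealP (p : R) :
  reflect (exists a : 'I_m -> R, p = \sum_(i < m) a i * tnth g i)
          (p \in genideal).
Proof. exact: boolp.asboolP. Qed.

Lemma genideal_zmod_closed : zmod_closed genideal.
Proof.
split=> [|p q /genidealP[a ->] /genidealP[b ->]]; apply/genidealP.
  by exists (fun=> 0); rewrite big1 // => i _; rewrite mul0r.
exists (fun i => a i - b i); rewrite -sumrB.
by apply: eq_bigr => i _; rewrite mulrBl.
Qed.

HB.instance Definition _ :=
  GRing.isZmodClosed.Build R genideal genideal_zmod_closed.

End GeneratedIdeal.

(* [idealr] only covers proper ideals, so the quotient is the additive one,    *)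
(* [{quot I}], which also makes sense when I is the whole ring. The image of k *)
(* in it consists of the classes of the constant polynomials.                  *)
Definition is_constant (k : fieldType) (m : nat)
    (I : zmodClosed {mpoly k[m]}) (c : Quotient.quot I) : Prop :=
  (1 \notin I /\ exists a : k, c = \pi_(Quotient.quot I) a%:MP)
  \/ (1 \in I /\ c = 0).

Section PolynomialMorphisms.
Variables (k : fieldType) (n : nat).
Implicit Types f g : n.-tuple {mpoly k[n]}.

Definition pm_id : n.-tuple {mpoly k[n]} := [tuple 'X_i | i < n].

Definition pm_comp f g : n.-tuple {mpoly k[n]} :=
  [tuple tnth f i \mPo g | i < n].

Definition pm_invertible f : Prop :=
  exists g, pm_comp f g = pm_id /\ pm_comp g f = pm_id.

Definition pm_sub f (q : n.-tuple k) : n.-tuple {mpoly k[n]} :=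
  [tuple tnth f i - (tnth q i)%:MP | i < n].

Definition Jac f : {mpoly k[n]} := \det (\matrix_(i, j) (tnth f i)^`M(j)).

End PolynomialMorphisms.

Section Bezoutian.
Variables (k : fieldType) (n : nat).
Implicit Types f : n.-tuple {mpoly k[n]}.

(* k[x, y] is {mpoly k[n + n]}, the first n variables being the x_i. *)
Definition Xvar (i : 'I_n) : {mpoly k[n + n]} := 'X_(lshift n i).
Definition Yvar (i : 'I_n) : {mpoly k[n + n]} := 'X_(rshift n i).

Definition xvars : n.-tuple {mpoly k[n + n]} := [tuple Xvar i | i < n].
Definition yvars : n.-tuple {mpoly k[n + n]} := [tuple Yvar i | i < n].

(* The point whose first j coordinates are y's and whose others are x's. *)
Definition yxvars (j : nat) : n.-tuple {mpoly k[n + n]} :=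
  [tuple if (i < j)%N then Yvar i else Xvar i | i < n].

Definition Delta_num f (i j : 'I_n) : {mpoly k[n + n]} :=
  (tnth f i \mPo yxvars j) - (tnth f i \mPo yxvars j.+1).

Lemma Delta_subproof f (i j : 'I_n) :
  exists d : {mpoly k[n + n]}, d * (Xvar j - Yvar j) == Delta_num f i j.
Proof.
pose dvd (p : {mpoly k[n + n]}) :=
  exists d : {mpoly k[n + n]}, d * (Xvar j - Yvar j) = p.
suff [d dE] : dvd (Delta_num f i j) by exists d; apply/eqP.
have dvd0 : dvd 0 by exists 0; rewrite mul0r.
have dvdD p q : dvd p -> dvd q -> dvd (p + q).
  by move=> [d <-] [e <-]; exists (d + e); rewrite mulrDl.
have dvdM p q : dvd q -> dvd (p * q).
  by move=> [d <-]; exists (p * d); rewrite mulrA.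
rewrite /Delta_num !comp_mpolyEX -sumrB.
apply: (big_ind dvd) => // m _.
rewrite -scalerBr -mul_mpolyC; apply: (dvdM).
rewrite !comp_mpolyX (bigD1 j) //= [X in _ - X](bigD1 j) //=.
rewrite !tnth_mktuple ltnn ltnSn.
have -> : \prod_(l < n | l != j) tnth (yxvars j.+1) l ^+ m l
        = \prod_(l < n | l != j) tnth (yxvars j) l ^+ m l.
  apply: eq_bigr => l lj; rewrite !tnth_mktuple ltnS leq_eqVlt.
  by rewrite (negbTE (lj : (l : nat) != j)).
rewrite -mulrBl mulrC subrXX; apply: (dvdM).
by rewrite mulrC; apply: (dvdM); exists 1; rewrite mul1r.
Qed.

(* The divided difference, as the quotient in the integral domain k[x, y]. *)
Definition Delta f (i j : 'I_n) : {mpoly k[n + n]} :=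
  xchoose (Delta_subproof f i j).

Lemma DeltaE f (i j : 'I_n) :
  Delta f i j * (Xvar j - Yvar j) = Delta_num f i j.
Proof. exact/eqP/(xchooseP (Delta_subproof f i j)). Qed.

Definition Bez f : {mpoly k[n + n]} := \det (\matrix_(i, j) Delta f i j).

Definition bez_gens f : (n + n).-tuple {mpoly k[n + n]} :=
  [tuple of [tuple tnth f i \mPo xvars | i < n]
         ++ [tuple tnth f i \mPo yvars | i < n]].

Definition bez_ideal f : zmodClosed {mpoly k[n + n]} :=
  GRing.ZmodClosed.clone _ (genideal (bez_gens f)) _.

Definition reduced_Bez f : Quotient.quot (bez_ideal f) :=
  \pi_(Quotient.quot (bez_ideal f)) (Bez f).

End Bezoutian.

(* Main.v *)
(** If [a] and [b] lie in the same fibre of [f], the adjugate of the matrix of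
    divided differences gives [Bez f (a, b) * (a_j - b_j) = 0], whereas
    [Bez f (a, a) = Jac f (a)] is a nonzero constant: so constancy of all the
    reduced Bezoutians makes [f] injective. The polynomials [f_j(x) - f_j(y)]
    and [Bez f] then have no common zero; by the Nullstellensatz they generate
    the unit ideal, and multiplying by [x_i - y_i] yields the certificate
    [x_i - y_i = \sum_j h_ij(x, y) (f_j(x) - f_j(y))].
    Reduced to finite fields, this certificate makes [f] surjective (Ax). Read
    as an equality in [k[x] \otimes_{k[f]} k[x]], it gives
    [Q_i(f) x_i = P_i(f)] with [Q_i(f) != 0]. Finally [Q_i] divides [P_i]: on a
    line [l], Newton iteration lifts [l] through [f] to any order near each of
    its points, so that [Q_i(l)] divides [P_i(l)] locally, hence globally; and
    divisibility along all lines in a suitable direction is divisibility.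
    Thus the [P_i / Q_i] form a polynomial inverse. *)
Require Import Defs.
From mathcomp Require Import all_boot all_order all_algebra all_field.
From mathcomp Require Import generic_quotient ring_quotient mpoly ring zify.
From mathcomp Require boolp classical_sets.
From HB Require Import structures.

Set Implicit Arguments.
Unset Strict Implicit.
Unset Printing Implicit Defensive.

Import GRing.Theory.
Local Open Scope ring_scope.

(** * Extension of specializations *)

Lemma ex_minimal (T : Type) (m : T -> nat) (P : T -> Prop) :
  (exists t, P t) -> exists2 t, P t & forall u, P u -> (m t <= m u)%N.
Proof.
move=> [t0 Pt0].
pose Q i := boolp.asbool (exists2 t, P t & m t = i).
have exQ : exists i, Q i by exists (m t0); apply/boolp.asboolP; exists t0.
case: (ex_minnP exQ) => i /boolp.asboolP[t Pt mt] imin.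
exists t => // u Pu; rewrite mt; apply: imin; apply/boolp.asboolP.
by exists u.
Qed.

Section PolyEval.
Variables (A B : comNzRingType) (e : {rmorphism A -> B}) (x : B).

Definition pev : {rmorphism {poly A} -> B} := horner_eval x \o map_poly e.

Arguments pev : simpl never.

Lemma pevC c : pev c%:P = e c.
Proof. by rewrite /pev /= map_polyC /horner_eval /= hornerC. Qed.

Lemma pevX : pev 'X = x.
Proof. by rewrite /pev /= map_polyX /horner_eval /= hornerX. Qed.

Lemma pevE p : pev p = (map_poly e p).[x].
Proof. by []. Qed.

Lemma pevZ c p : pev (c *: p) = e c * pev p.
Proof. by rewrite -mul_polyC rmorphM pevC. Qed.

(** Top coefficients in the kernel of [e] hide the true degree; pseudo-division over [A] needs a
    leading coefficient that survives. *)
Lemma map_poly_truncate p : map_poly e p != 0 ->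
  exists p', [/\ map_poly e p' = map_poly e p, e (lead_coef p') != 0
               & size p' = size (map_poly e p)].
Proof.
move=> p0; set d := size (map_poly e p).
have d0 : (0 < d)%N by rewrite size_poly_gt0.
pose p' := \poly_(i < d) p`_i.
have lc : e p`_d.-1 != 0.
  by rewrite -coef_map -lead_coefE lead_coef_eq0.
have c0 : p`_d.-1 != 0 by apply: contraNneq lc => ->; rewrite rmorph0.
have sp : size p' = d by rewrite size_poly_eq.
exists p'; split => //.
- apply/polyP => i; rewrite !coef_map coef_poly; case: ltnP => // di.
  rewrite -[RHS]coef_map nth_default //. exact: raddf0.
by rewrite lead_coefE sp coef_poly prednK // leqnn.
Qed.

End PolyEval.

Lemma leq_size_map_poly (A B : comNzRingType) (e : {rmorphism A -> B}) (p : {poly A}) :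
  (size (map_poly e p) <= size p)%N.
Proof. exact: size_poly. Qed.

Lemma closed_nonroot (F : closedFieldType) (p : {poly F}) :
  p != 0 -> exists x, p.[x] != 0.
Proof.
(* A root [x] of this polynomial satisfies [p(x) * x = 1]. *)
move=> p0; have : size (p * 'X - 1%:P) != 1.
  rewrite size_polyDl size_mulX //; last by rewrite size_polyN size_polyC oner_eq0 ltnS size_poly_gt0.
  by rewrite eqSS size_poly_eq0.
move=> /closed_rootP[x]; rewrite /root !hornerE subr_eq0 => /eqP px.
by exists x; apply: contra_eq_neq px => ->; rewrite mul0r eq_sym oner_eq0.
Qed.

(* Chevalley's extension theorem. A morphism [phi] whose kernel contains that of *)
(* [e] is a morphism on the subring [e(A)] of [L]; sending [x] to [xi] extends   *)
(* it to [e(A)[x]].                                                              *)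
Lemma extend_specialization1 (A : comNzRingType) (L : idomainType)
    (e : {rmorphism A -> L}) (x : L) (b : {poly A}) :
  pev e x b != 0 ->
  exists2 w, e w != 0 & forall (W : closedFieldType) (phi : {rmorphism A -> W}),
    (forall a, e a = 0 -> phi a = 0) -> phi w != 0 ->
    exists2 xi, (forall p, pev e x p = 0 -> pev phi xi p = 0)
              & pev phi xi b != 0.
Proof.
move=> bx.
have [[p0 p0P]|trans] :=
  boolp.pselect (exists p, pev e x p = 0 /\ map_poly e p != 0); last first.
  have {}trans p : pev e x p = 0 -> map_poly e p = 0.
    by move=> px; apply/eqP; apply: boolp.contrapT => /negP ?; apply: trans; exists p.
  (* Transcendental case: every [xi] respects the relations and only has to avoid the roots of the
     image of [b]. *)
  set d := (size (map_poly e b)).-1.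
  have : (map_poly e b)`_d != 0.
    rewrite -lead_coefE lead_coef_eq0.
    by apply: contraNneq bx; rewrite pevE => ->; rewrite horner0.
  rewrite coef_map => bd; exists b`_d => // W phi ker phib.
  have /closed_nonroot[xi xiP] : map_poly phi b != 0.
    by apply: contraNneq phib => /polyP/(_ d); rewrite coef_map coef0 => ->.
  exists xi => // p /trans pe; rewrite pevE.
  suff -> : map_poly phi p = 0 by rewrite horner0.
  apply/polyP => i; rewrite coef_map coef0; apply: ker.
  by rewrite -coef_map pe coef0.
(* A relation [p] satisfied by [x], of minimal degree: pseudo-division by [p]    *)
(* shows that every root of [p] is a specialization of [x] as soon as the        *)
(* leading coefficient of [p] survives.                                          *)
have [p1 [p1x p1e] p1min] := ex_minimal (fun p : {poly A} => size (map_poly e p))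
  (ex_intro (fun p => pev e x p = 0 /\ map_poly e p != 0) p0 p0P).
have [p [pe lp sp]] := map_poly_truncate p1e.
have px : pev e x p = 0 by rewrite pevE pe -pevE.
have {}p1min g : pev e x g = 0 -> (size (map_poly e g) < size p)%N -> map_poly e g = 0.
  move=> gx; rewrite sp ltnNge => gs; apply/eqP; apply: contraNT gs => ge.
  by apply: p1min.
have {}pe : map_poly e p != 0 by rewrite pe.
have {p1 p1x p1e}sp : size p = size (map_poly e p).
  by rewrite size_map_poly_id0.
have pn0 : p != 0 by apply: contraNneq lp => ->; rewrite lead_coef0 rmorph0.
(* Modulo the relations, some multiple of [b] is a nonzero constant [w0].        *)
pose U u := pev e x u != 0 /\ exists c, pev e x u = pev e x (b * c).
have exU : exists u, U u by exists b; split => //; exists 1; rewrite mulr1.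
have [u1 [u1x [c u1c]] u1min] := ex_minimal (fun u : {poly A} => size (map_poly e u)) exU.
have u1e : map_poly e u1 != 0.
  by apply: contraNneq u1x; rewrite pevE => ->; rewrite horner0.
have [u [ue lu su]] := map_poly_truncate u1e.
have ux : pev e x u != 0 by rewrite pevE ue.
have uc : pev e x u = pev e x (b * c) by rewrite -u1c !pevE ue.
have {}u1min v : U v -> (size u <= size (map_poly e v))%N by move=> /u1min; rewrite su.
have {ue u1e} sue : size u = size (map_poly e u) by rewrite size_map_poly_id0.
have un0 : u != 0 by apply: contraNneq lu => ->; rewrite lead_coef0 rmorph0.
have {u1 u1x u1c su} szup : (size u < size p)%N.
  have /(congr1 (pev e x)) := Pdiv.ComRing.rdivp_eq p u.
  rewrite pevZ rmorphD rmorphM px mulr0 add0r rmorphXn => rE.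
  apply: (@leq_ltn_trans (size (map_poly e (Pdiv.Ring.rmodp u p)))); last first.
    apply: leq_ltn_trans (leq_size_map_poly _ _) _.
    by rewrite Pdiv.Ring.ltn_rmodp.
  apply: u1min; split; first by rewrite -rE mulf_neq0 // expf_neq0.
  exists (c * (lead_coef p ^+ Pdiv.Ring.rscalp u p)%:P).
  by rewrite mulrA rmorphM -uc pevC rmorphXn mulrC rE.
(* Were [u] not constant, divide [p] by [u]. A remainder nonzero at [x] would be a smaller element
   of [U]; otherwise the quotient is a relation shorter than [p]. *)
have szu : size u = 1%N.
  apply/eqP; rewrite eqn_leq size_poly_gt0 un0 andbT leqNgt; apply/negP => u2.
  have dE := Pdiv.ComRing.rdivp_eq u p.
  set s := Pdiv.Ring.rdivp p u in dE; set r := Pdiv.Ring.rmodp p u in dE.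
  have szr : (size r < size u)%N by rewrite Pdiv.Ring.ltn_rmodp.
  have := congr1 (pev e x) dE.
  rewrite pevZ px mulr0 rmorphD rmorphM => /esym dx.
  have rx : pev e x r = 0.
    apply/eqP; apply: contraTT szr => rx; rewrite -leqNgt.
    apply: leq_trans (leq_size_map_poly e _); apply: u1min; split => //.
    exists (- (c * s)); rewrite mulrN mulrA rmorphN rmorphM -uc.
    by move/eqP: dx; rewrite addrC addr_eq0 mulrC => /eqP.
  have sx : pev e x s = 0.
    by move/eqP: dx; rewrite rx addr0 mulf_eq0 (negPf ux) orbF => /eqP.
  have re : map_poly e r = 0.
    apply: p1min => //; apply: leq_ltn_trans (leq_size_map_poly _ _) _.
    exact: ltn_trans szr szup.
  have := congr1 (map_poly e) dE; rewrite rmorphD rmorphM /= re addr0 map_polyZ /=.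
  move=> pse; have se : map_poly e s != 0.
    apply: contraNneq pe => se; move/eqP: pse.
    by rewrite se mul0r -mul_polyC mulf_eq0 polyC_eq0 rmorphXn expf_eq0 (negPf lu) andbF.
  have := congr1 (fun q : {poly _} => size q) pse; rewrite /=.
  rewrite size_scale ?rmorphXn ?expf_neq0 // size_mul //; last by rewrite -size_poly_gt0 -sue (ltn_trans _ u2).
  rewrite -sp -sue => ssz; case/eqP: se; apply: p1min => //.
  rewrite ssz; case: (size u) u2 => [|[|k]] // _.
  by rewrite !addnS /= ltnS leq_addr.
move/eqP: szu; case/size_poly1P => w0 w0n uE.
have w0e : e w0 != 0 by move: ux; rewrite uE pevC.
(* The first factor keeps [p] nonconstant, so that it has a root [xi]; the second keeps [b] nonzero
   there, [w0] being the value of [b * c]. *)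
exists (lead_coef p * w0); first by rewrite rmorphM mulf_neq0.
move=> W phi ker; rewrite rmorphM mulf_eq0 negb_or => /andP[plp pw0].
have /closed_rootP[xi] : size (map_poly phi p) != 1%N.
  rewrite size_map_poly_id0 //; apply: contra_neqN lp => /size_poly1P[l _ pl].
  by move: px; rewrite pl pevC lead_coefC => ->.
rewrite rootE -pevE => /eqP xip.
have kerp g : pev e x g = 0 -> pev phi xi g = 0.
  move=> gx; have dE := Pdiv.ComRing.rdivp_eq p g.
  have := congr1 (pev e x) dE.
  rewrite pevZ gx mulr0 rmorphD rmorphM px mulr0 add0r => /esym rx.
  have re : map_poly e (Pdiv.Ring.rmodp g p) = 0.
    apply: p1min => //; apply: leq_ltn_trans (leq_size_map_poly _ _) _.
    by rewrite Pdiv.Ring.ltn_rmodp.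
  have rphi : map_poly phi (Pdiv.Ring.rmodp g p) = 0.
    apply/polyP => i; rewrite coef_map coef0; apply: ker.
    by rewrite -coef_map re coef0.
  have := congr1 (pev phi xi) dE.
  rewrite pevZ rmorphD rmorphM xip mulr0 add0r [RHS]pevE rphi horner0.
  by move/eqP; rewrite mulf_eq0 rmorphXn expf_eq0 (negPf plp) andbF => /eqP.
exists xi => //.
have /kerp : pev e x (u - b * c) = 0 by rewrite rmorphB uc subrr.
move/eqP; rewrite rmorphB subr_eq0 uE pevC rmorphM => /eqP w0E.
by apply: contraNneq pw0 => bxi; rewrite w0E bxi mul0r.
Qed.

Lemma mpoly_alg_ind (n : nat) (R : nzRingType) (P : {mpoly R[n]} -> Prop) :
  (forall c, P c%:MP) -> (forall i, P 'X_i) ->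
  (forall p q, P p -> P q -> P (p + q)) ->
  (forall p q, P p -> P q -> P (p * q)) -> forall p, P p.
Proof.
move=> PC PX PD PM.
have PXm (m : 'X_{1..n}) : P 'X_[m].
  rewrite mpolyXE_id; apply: big_ind => [||i _]; [exact: (PC 1)|exact: PM|].
  by elim: (m i) => [|d IHd]; [exact: (PC 1)|rewrite exprS; apply: PM].
elim/mpolyind => [|c m p _ _ Pp]; first exact: (PC 0).
by apply: PD => //; rewrite -mul_mpolyC; apply: PM.
Qed.

Lemma eq_rmorph_mpoly (n : nat) (A B : comNzRingType)
    (phi psi : {rmorphism {mpoly A[n]} -> B}) :
  (forall c, phi c%:MP = psi c%:MP) -> (forall i, phi 'X_i = psi 'X_i) ->
  phi =1 psi.
Proof.
move=> eqC eqX; elim/mpoly_alg_ind => // p q pE qE.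
  by rewrite !rmorphD pE qE.
by rewrite !rmorphM pE qE.
Qed.

Section Mmap.
Variables (n : nat) (A B : comNzRingType).
Implicit Types (e : {rmorphism A -> B}) (h : 'I_n -> B).

Lemma mmapXU e h i : mmap e h 'X_i = h i.
Proof. by rewrite mmapX mmap1U. Qed.

Lemma eq_mmap e h1 h2 : h1 =1 h2 -> mmap e h1 =1 mmap e h2.
Proof.
move=> eqh; apply: eq_rmorph_mpoly => [c|i]; rewrite /= ?mmapC //.
by rewrite !mmapXU.
Qed.

End Mmap.

Lemma rmorph_mmap (n : nat) (A B C : comNzRingType) (e : {rmorphism A -> B})
    (f : {rmorphism B -> C}) (h : 'I_n -> B) (p : {mpoly A[n]}) :
  f (mmap e h p) = mmap (f \o e) (f \o h) p.
Proof.
move: p; apply: (@eq_rmorph_mpoly _ _ _ (f \o mmap e h)) => [c|i].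
  by rewrite /= !mmapC.
by rewrite /= !mmapXU.
Qed.

Section Peel.
Variable m : nat.

Definition fcons (T : Type) (x : T) (a : 'I_m -> T) (i : 'I_m.+1) : T :=
  if unlift ord0 i is Some j then a j else x.

Lemma eq_fcons (T : Type) (a : 'I_m.+1 -> T) :
  fcons (a ord0) (a \o lift ord0) =1 a.
Proof. by move=> i; rewrite /fcons /=; case: unliftP => [j ->|->]. Qed.

(** The variable of index 0 moves into the coefficients, so that elements can be adjoined one at a
    time. *)
Definition peel (A : comNzRingType) : {rmorphism {mpoly A[m.+1]} -> {mpoly {poly A}[m]}} :=
  mmap (@mpolyC m {poly A} \o polyC) (fcons 'X%:MP (fun j => 'X_j)).

Lemma mmap_peel (A B : comNzRingType) (e : {rmorphism A -> B}) x a p :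
  mmap (pev e x) a (peel A p) = mmap e (fcons x a) p.
Proof.
rewrite /peel /= rmorph_mmap; move: p; apply: eq_rmorph_mpoly => [c|i] /=.
  by rewrite !mmapC /= mmapC; apply: pevC.
rewrite !mmapXU /fcons /=; case: unliftP => [j _|_]; first by rewrite mmapXU.
by rewrite mmapC; apply: pevX.
Qed.

End Peel.

(** Induction on [m]: the other elements are adjoined over the polynomials in the first one, which
    leaves a nonvanishing condition [v] on that element. *)
Lemma extend_specialization (m : nat) (A : comNzRingType) (L : idomainType)
    (e : {rmorphism A -> L}) (a : 'I_m -> L) (b : {mpoly A[m]}) :
  mmap e a b != 0 ->
  exists2 w, e w != 0 & forall (W : closedFieldType) (phi : {rmorphism A -> W}),
    (forall c, e c = 0 -> phi c = 0) -> phi w != 0 ->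
    exists2 alpha : 'I_m -> W, (forall p, mmap e a p = 0 -> mmap phi alpha p = 0)
                             & mmap phi alpha b != 0.
Proof.
elim: m => [|m IHm] in A e a b *.
  rewrite [b]nvar0_mpolyC mmapC => eb.
  exists b@_0%MM => // W phi ker phib; exists (fun _ => 0); last by rewrite mmapC.
  by move=> p; rewrite [p]nvar0_mpolyC !mmapC; apply: ker.
rewrite -(eq_mmap e (eq_fcons a)) -mmap_peel => /IHm[v /extend_specialization1[w ew wP] vP].
exists w => // W phi ker /(wP W phi ker)[xi xiP /(vP W (pev phi xi) xiP)[alpha alphaP alphab]].
exists (fcons xi alpha) => [p|]; last by rewrite -mmap_peel.
by rewrite -(eq_mmap e (eq_fcons a)) -!mmap_peel; apply: alphaP.
Qed.

(** The generic point [(X_1, ..., X_n)], where [p] does not vanish, specializes to a point of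
    [k^n]. *)
Lemma mpoly_nonroot (n : nat) (k : closedFieldType) (p : {mpoly k[n]}) :
  p != 0 -> exists v : 'I_n -> k, p.@[v] != 0.
Proof.
move=> p0; have : mmap (@mpolyC n k) (fun i => 'X_i) p != 0.
  suff -> : mmap (@mpolyC n k) (fun i => 'X_i) p = p by [].
  move: p {p0}; apply: (@eq_rmorph_mpoly _ _ _ _ idfun) => [c|i] /=.
    by rewrite mmapC.
  by rewrite mmapXU.
move=> /extend_specialization[w w0 wP].
have [//||v _ pv] := wP k idfun; last by exists v.
  by move=> c /eqP; rewrite mpolyC_eq0 => /eqP.
by move: w0; rewrite mpolyC_eq0.
Qed.

Lemma mpoly_eval_inj (n : nat) (k : closedFieldType) (p q : {mpoly k[n]}) :
  (forall v, p.@[v] = q.@[v]) -> p = q.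
Proof.
move=> pq; apply/eqP; rewrite -subr_eq0; apply/negPn/negP => /mpoly_nonroot[v].
by rewrite mevalB pq subrr eqxx.
Qed.

(** * The weak Nullstellensatz *)

Section MaximalIdeal.
Variable R : comNzRingType.
Implicit Types I M : R -> Prop.

Definition properI I :=
  [/\ I 0, forall x y, I x -> I y -> I (x + y), forall a x, I x -> I (a * x)
    & ~ I 1].

Lemma ex_maximal_ideal I : properI I ->
  exists M, [/\ properI M, forall x, I x -> M x
              & forall u, ~ M u -> exists a, M (1 - a * u)].
Proof.
(* [I] is joined to each set so that the empty chain, too, has an admissible union. *)
move=> [I0 ID IM I1]; pose P (X : R -> Prop) := properI (fun x => X x \/ I x).
have [F FP Ftot|A [PA Amax]] := @classical_sets.Zorn_bigcup R P.
  split=> [|x y|a x|]; first by right.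
  - case=> [[X FX Xx]|Ix] [[Y FY Yy]|Iy]; last by right; apply: ID.
    + have [XY|YX] := Ftot X Y FX FY.
        have [_ YD _ _] := FP Y FY.
        have [||?|?] := YD x y; [by left; apply: XY|by left|by left; exists Y|by right].
      have [_ XD _ _] := FP X FX.
      have [||?|?] := XD x y; [by left|by left; apply: YX|by left; exists X|by right].
    + have [_ XD _ _] := FP X FX.
      have [||?|?] := XD x y; [by left|by right|by left; exists X|by right].
    + have [_ YD _ _] := FP Y FY.
      have [||?|?] := YD x y; [by right|by left|by left; exists Y|by right].
  - case=> [[X FX Xx]|Ix]; last by right; apply: IM.
    have [_ _ XM _] := FP X FX.
    have [|?|?] := XM a x; [by left|by left; exists X|by right].
  - case=> [[X FX Xx]|//]; have [_ _ _ X1] := FP X FX.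
    by apply: X1; left.
set M := fun x => A x \/ I x in PA *; have [M0 MD MM M1] := PA.
exists M; split => // [x Ix|w Mw]; first by right.
pose B w x := exists m a, M m /\ x = m + a * w.
have [m [a [Mm ->]]] : B w 1; last by exists a; rewrite addrK.
apply: boolp.contrapT => Bw1; apply: (Amax (B w)).
  split=> [x Ax|/(_ w) BA]; first by exists x, 0; rewrite mul0r addr0; split => //; left.
    apply: Mw; left; apply: BA; exists 0, 1.
    by rewrite mul1r add0r.
  have IB x : (B w x \/ I x) -> B w x.
    by case=> // Ix; exists x, 0; rewrite mul0r addr0; split => //; right.
  split=> [|x y /IB[m1 [a1 [m1M ->]]] /IB[m2 [a2 [m2M ->]]]|a x /IB[m [a' [mM ->]]]|/IB//].
  - by right.
  - left; exists (m1 + m2), (a1 + a2); split; first exact: MD.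
    by rewrite mulrDl addrACA.
  - left; exists (a * m), (a * a'); split; first exact: MM.
    by rewrite mulrDr mulrA.
Qed.

Lemma proper_ideal_field I : properI I ->
  exists (L : fieldType) (f : {rmorphism R -> L}), forall x, I x -> f x = 0.
Proof.
move=> /ex_maximal_ideal[M [[M0 MD MM M1] IM Mmax]].
pose S : R -> bool := fun x => boolp.asbool (M x).
have SP x : reflect (M x) (x \in S) by apply: boolp.asboolP.
have Sideal : idealr_closed S.
  split=> [||a u v]; [exact/SP|exact/SP|move=> /SP Mu /SP Mv].
  by apply/SP; apply: MD => //; apply: MM.
pose PS : idealr R := HB.pack S (isIdealr.Build R S Sideal).
pose Q : comNzRingType := {ideal_quot PS}.
pose pi : {rmorphism R -> Q} := (\pi_{ideal_quot PS})%qT.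
have piE x : (pi x == 0) = (x \in S).
  by rewrite -(rmorph0 pi) -[x in RHS]subr0; apply/esym/(Quotient.idealrBE PS).
have invP (x : Q) : exists y, if x == 0 then y = 0 else y * x = 1.
  case: eqP => [_|/eqP]; first by exists 0.
  rewrite -[x]reprK -[(\pi_Q)%qT _]/(pi _) piE => /SP/Mmax[a aP].
  exists (pi a); apply/eqP; rewrite -rmorphM -(rmorph1 pi) eq_sym -subr_eq0 -rmorphB piE.
  exact/SP.
have [inv invE] := boolp.choice invP.
have mulVf x : x != 0 -> inv x * x = 1 by move=> x0; have := invE x; rewrite (negPf x0).
have inv0 : inv 0 = 0 by have := invE 0; rewrite eqxx.
pose L : fieldType := HB.pack Q (GRing.ComNzRing_isField.Build Q mulVf inv0).
exists L, pi => x /IM Mx; apply/eqP; rewrite piE; exact/SP.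
Qed.
End MaximalIdeal.

(** If the [g i] generate a proper ideal, they have a common zero in some field [L], formed by the
    images of the variables; it specializes to a zero in [k^n]. *)
Lemma weak_nullstellensatz (k : closedFieldType) (n r : nat) (g : 'I_r -> {mpoly k[n]}) :
  (forall v, exists i, (g i).@[v] != 0) ->
  exists a : 'I_r -> {mpoly k[n]}, 1 = \sum_(i < r) a i * g i.
Proof.
move=> nozero; apply: boolp.contrapT => g1.
pose I p := exists a : 'I_r -> {mpoly k[n]}, p = \sum_(i < r) a i * g i.
have /proper_ideal_field[L [f fI]] : properI I.
  split=> // [|x y [a ->] [b ->]|c x [a ->]].
  - by exists (fun=> 0); rewrite big1 // => i _; rewrite mul0r.
  - exists (fun i => a i + b i); rewrite -big_split.
    by apply: eq_bigr => i _; rewrite mulrDl.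
  - exists (fun i => c * a i); rewrite mulr_sumr.
    by apply: eq_bigr => i _; rewrite mulrA.
pose e : {rmorphism k -> L} := f \o @mpolyC n k.
have mE : mmap e (fun i => f 'X_i) =1 f.
  by apply: eq_rmorph_mpoly => [c|i] /=; rewrite ?mmapC ?mmapXU.
have : mmap e (fun i => f 'X_i) 1 != 0 by rewrite mE rmorph1 oner_eq0.
move=> /extend_specialization[w w0 wP].
have [||v vP _] := wP k idfun.
- by move=> c /eqP; rewrite fmorph_eq0 => /eqP.
- by apply: contraNneq w0 => /= ->; rewrite rmorph0.
have [i /eqP[]] := nozero v; apply: vP; rewrite mE; apply: fI.
exists (fun j => (j == i)%:R); rewrite (bigD1 i) //= eqxx mul1r big1 ?addr0 // => j ji.
by rewrite (negPf ji) mul0r.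
Qed.

(** * Reduction to finite fields *)

Section LocallyFinite.
Variables (p : nat) (W : closedFieldType).
Hypotheses (p_pr : prime p) (pW : p \in [pchar W]).

Lemma pchar_pnat r : [pchar W].-nat (p ^ r)%N.
Proof. by rewrite pnatX pnatE // pW. Qed.

Lemma expB_pchar r (x y : W) : (x - y) ^+ (p ^ r) = x ^+ (p ^ r) - y ^+ (p ^ r).
Proof. by rewrite exprDn_pchar ?exprNn_pchar // pchar_pnat. Qed.

(** With [r] a common multiple of the exponents, [t] consists of roots of [X^(p^r) - X], which form
    a finite ring because Frobenius is additive. *)
Lemma finite_subring_pchar (t : seq W) :
  {in t, forall x, exists2 r, (0 < r)%N & x ^+ (p ^ r) = x} ->
  exists S : seq W, [/\ {subset t <= S}, 1 \in S,
    {in S &, forall x y, x - y \in S} & {in S &, forall x y, x * y \in S}].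
Proof.
move=> tP.
have [r r0 rP] : exists2 r, (0 < r)%N & {in t, forall x, x ^+ (p ^ r) = x}.
  elim: t tP => [|x t IHt] tP; first by exists 1%N.
  have [|r r0 rP] := IHt; first by move=> y yt; apply: tP; rewrite inE yt orbT.
  have [|d d0 dP] := tP x; first by rewrite inE eqxx.
  exists (r * d)%N; first by rewrite muln_gt0 r0.
  have iterP y a b : y ^+ (p ^ a) = y -> y ^+ (p ^ (a * b)) = y.
    by move=> ya; elim: b => [|b IHb]; rewrite ?muln0 ?expr1 // mulnS expnD exprM ya.
  move=> y; rewrite inE => /predU1P[->|/rP]; last exact: iterP.
  by rewrite mulnC; apply: iterP.
pose P : {poly W} := 'X^(p ^ r) - 'X.
have rootP x : root P x = (x ^+ (p ^ r) == x) by rewrite rootE !hornerE subr_eq0.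
have P0 : P != 0.
  rewrite -size_poly_eq0 size_polyDl ?size_polyXn // size_polyN size_polyX ltnS.
  by rewrite (leq_trans (prime_gt1 p_pr)) // -{1}[p]expn1 leq_exp2l // prime_gt1.
have [S SE] := closed_field_poly_normal P.
have memS x : (x \in S) = (x ^+ (p ^ r) == x).
  by rewrite -rootP SE rootZ ?lead_coef_eq0 // root_prod_XsubC.
exists S; split=> [x xt||x y|x y]; rewrite !memS ?expr1n //.
  by rewrite rP.
  by move=> /eqP xS /eqP yS; rewrite expB_pchar xS yS.
by move=> /eqP xS /eqP yS; rewrite exprMn xS yS.
Qed.

(** Frobenius fixes the coefficients of [q], hence maps roots to roots. Two iterates of [x]
    therefore coincide, and injectivity of Frobenius makes [x] periodic. *)
Lemma integral_Fp_periodic (iota : {rmorphism 'F_p -> W}) (x : W) :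
  integralOver iota x -> exists2 r, (0 < r)%N & x ^+ (p ^ r) = x.
Proof.
move=> [q q_mon qx].
have frob c : iota c ^+ p = iota c.
  by have := expf_card c; rewrite card_Fp // -rmorphXn => ->.
have q0 : map_poly iota q != 0 by rewrite map_poly_eq0 monic_neq0.
have rootX y : root (map_poly iota q) y -> root (map_poly iota q) (y ^+ p).
  move=> /rootP qy; apply/rootP.
  suff -> : (map_poly iota q).[y ^+ p] = (map_poly iota q).[y] ^+ p.
    by rewrite qy expr0n gtn_eqF // prime_gt0.
  rewrite !horner_coef -!(pFrobenius_autE pW) rmorph_sum; apply: eq_bigr => i _.
  rewrite rmorphM coef_map /= !(pFrobenius_autE pW) frob.
  by rewrite -!exprM mulnC.
have rootXr r : root (map_poly iota q) (x ^+ (p ^ r)).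
  by elim: r => [|r IHr]; rewrite ?expr1 // expnSr exprM; apply: rootX.
pose s := mkseq (fun j => x ^+ (p ^ j)) (size (map_poly iota q)).
have : ~~ uniq s.
  apply/negP => /(max_poly_roots q0); rewrite size_mkseq ltnn => /(_ _)/notF; apply.
  by apply/allP => _ /mapP[j _ ->]; apply: rootXr.
move=> /(uniqPn 0)[i [j [ij]]]; rewrite size_mkseq => js.
rewrite !nth_mkseq ?(ltn_trans ij) // => eij.
exists (j - i)%N; first by rewrite subn_gt0.
have : (x ^+ (p ^ (j - i)) - x) ^+ (p ^ i) == 0.
  by rewrite expB_pchar eij -exprM -expnD subnK ?subrr // ltnW.
by rewrite expf_eq0 subr_eq0 => /andP[_ /eqP].
Qed.

End LocallyFinite.

Lemma ex_locally_finite_field (p : nat) : prime p ->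
  exists W : closedFieldType, p \in [pchar W] /\
    forall t : seq W, exists S : seq W, [/\ {subset t <= S}, 1 \in S,
      {in S &, forall x y, x - y \in S} & {in S &, forall x y, x * y \in S}].
Proof.
move=> p_pr; have [W [iota iotaP]] := countable_algebraic_closure 'F_p.
have pW : p \in [pchar W] by apply: (rmorph_pchar iota); apply: pchar_Fp.
exists W; split => // t; apply: (finite_subring_pchar p_pr pW) => x _.
exact: integral_Fp_periodic (iotaP x).
Qed.

Section LiftCoefficients.
Variables (n : nat) (A k : comNzRingType) (e : {rmorphism A -> k}).

Lemma lift_mpoly (p : {mpoly k[n]}) :
  (forall m, m \in msupp p -> exists a, e a = p@_m) ->
  exists P, map_mpoly e P = p.
Proof.
move=> pe.
have /boolp.choice[a aP] m : exists a, m \in msupp p -> e a = p@_m.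
  have [/pe[a aE]|_] := boolP (m \in msupp p); first by exists a.
  by exists 0.
exists (\sum_(m <- msupp p) a m *: 'X_[m]).
rewrite raddf_sum [RHS]mpolyE !big_seq; apply: eq_bigr => m mp.
by rewrite /= map_mpolyZ map_mpolyX aP.
Qed.

(** Transfers identities from [k] to [B]: lifted to [A], their defect has coefficients killed by
    [e], hence by [phi]. *)
Lemma ker_mmap (B : comNzRingType) (phi : {rmorphism A -> B}) (v : 'I_n -> B) P :
  (forall c, e c = 0 -> phi c = 0) -> map_mpoly e P = 0 -> mmap phi v P = 0.
Proof.
move=> ker eP; rewrite /mmap big1 // => m _; rewrite (ker (P@_m)) ?mul0r //.
by rewrite -mcoeff_map_mpoly eP mcoeff0.
Qed.

End LiftCoefficients.

Section Rename.
Variables (n N : nat) (s : 'I_n -> 'I_N).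

Definition mrename (A : comNzRingType) : {rmorphism {mpoly A[n]} -> {mpoly A[N]}} :=
  mmap (@mpolyC N A) (fun i => 'X_(s i)).

Lemma mmap_rename (A B : comNzRingType) (e : {rmorphism A -> B}) u p :
  mmap e u (mrename A p) = mmap e (u \o s) p.
Proof.
rewrite rmorph_mmap; move: p; apply: eq_rmorph_mpoly => [c|i] /=; rewrite ?mmapC ?mmapXU //=.
  by rewrite mmapC.
by rewrite mmapXU.
Qed.

Lemma map_mpoly_rename (A B : comNzRingType) (e : {rmorphism A -> B}) p :
  map_mpoly e (mrename A p) = mrename B (map_mpoly e p).
Proof.
move: p; apply: (@eq_rmorph_mpoly _ _ _ (map_mpoly e \o mrename A) (mrename B \o map_mpoly e)).
  by move=> c; rewrite /= mmapC !map_mpolyC mmapC.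
by move=> i; rewrite /= mmapXU !map_mpolyX mmapXU.
Qed.
End Rename.

(** The subring generated by [s] arises from the integers by adjoining finitely many elements, so it
    specializes in characteristic [p] as soon as [p] does not divide a certain nonzero integer
    [w]. *)
Lemma finite_specialization (k : fieldType) (s : seq k) : [pchar k] =i pred0 ->
  exists (A : comNzRingType) (e : {rmorphism A -> k}) (W : closedFieldType)
         (phi : {rmorphism A -> W}),
    [/\ {in s, forall x, exists a, e a = x}, forall a, e a = 0 -> phi a = 0
      & forall t : seq W, exists S : seq W, [/\ {subset t <= S}, 1 \in S,
      {in S &, forall x y, x - y \in S} & {in S &, forall x y, x * y \in S}]].
Proof.
move=> k0.
pose e0 : {rmorphism int -> k} := intr; pose a := fun i : 'I_(size s) => s`_i.
have [w w0 wP] : exists2 w : int, e0 w != 0 & forall (W : closedFieldType) (phi : {rmorphism int -> W}),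
    (forall c, e0 c = 0 -> phi c = 0) -> phi w != 0 ->
    exists alpha : 'I_(size s) -> W, (forall p, mmap e0 a p = 0 -> mmap phi alpha p = 0).
  have : mmap e0 a 1 != 0 by rewrite rmorph1 oner_eq0.
  move=> /extend_specialization[w w0 wP]; exists w => // W phi ker pw.
  by have [alpha ? _] := wP W phi ker pw; exists alpha.
have {}w0 : w != 0 by apply: contraNneq w0 => ->; rewrite rmorph0.
have [p wp p_pr] := prime_above `|w|%N.
have [W [pW Wfin]] := ex_locally_finite_field p_pr.
pose phi0 : {rmorphism int -> W} := intr.
have [||alpha alphaP] := wP W phi0.
- move=> c /eqP; case: c => c; rewrite /e0 /= ?NegzE ?rmorphN ?oppr_eq0 /=.
    by rewrite -pmulrn (pcharf0P k).1 // => /eqP ->.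
  by rewrite -pmulrn (pcharf0P k).1.
- rewrite /phi0 /= -(dvdz_pcharf pW) dvdzE /=; apply: contraL wp => /dvdn_leq.
  by rewrite absz_gt0 w0 -leqNgt => ->.
exists {mpoly int[size s]}, (mmap e0 a), W, (mmap phi0 alpha).
split => // x xs; exists 'X_(Ordinal (etrans (index_mem x s) xs)).
by rewrite /= mmapXU /a /= nth_index.
Qed.

Lemma mem_flatten_enum (n : nat) (T : eqType) (F : 'I_n -> seq T) i x :
  x \in F i -> x \in flatten [seq F j | j <- enum 'I_n].
Proof. by move=> xi; apply/flatten_mapP; exists i; rewrite ?mem_enum. Qed.

(* The certificate [h] of injectivity and a certificate that the system [f = q] *)
(* has no solution both survive the reduction to a finite ring, where injective *)
(* self-maps are onto. *)
Lemma injective_surjective (k : closedFieldType) (n : nat)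
    (f : 'I_n -> {mpoly k[n]}) (h : 'I_n -> 'I_n -> {mpoly k[n + n]}) :
  [pchar k] =i pred0 ->
  (forall i, 'X_(lshift n i) - 'X_(rshift n i) =
     \sum_j h i j * (mrename (@lshift n n) k (f j) - mrename (@rshift n n) k (f j))) ->
  forall q : 'I_n -> k, exists v, forall i, (f i).@[v] = q i.
Proof.
move=> k0 hE q; apply: boolp.contrapT => noq.
have [v|s sE] := @weak_nullstellensatz k n n (fun i => f i - (q i)%:MP).
  apply: boolp.contrapT => nov; apply: noq; exists v => i.
  apply/eqP; rewrite -subr_eq0; apply/negPn/negP => fqi; apply: nov; exists i.
  by rewrite mevalB mevalC.
pose cf N (p : {mpoly k[N]}) := [seq p@_m | m <- msupp p].
(* All scalars occurring in [f], in both certificates and in [q]. *)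
pose L := flatten [seq cf n (f j) | j <- enum 'I_n] ++ flatten [seq cf n (s j) | j <- enum 'I_n]
  ++ flatten [seq flatten [seq cf _ (h i j) | j <- enum 'I_n] | i <- enum 'I_n]
  ++ [seq q j | j <- enum 'I_n].
have [A [e [W [phi [Le ker Wfin]]]]] := finite_specialization L k0.
have cfP N (p : {mpoly k[N]}) : {subset cf N p <= L} -> exists P, map_mpoly e P = p.
  by move=> pL; apply: lift_mpoly => m mp; apply/Le/pL/map_f.
have /boolp.choice[F FE] i : exists P, map_mpoly e P = f i.
  by apply: cfP => x xi; rewrite !mem_cat (mem_flatten_enum xi).
have /boolp.choice[S SE] i : exists P, map_mpoly e P = s i.
  by apply: cfP => x xi; rewrite !mem_cat (mem_flatten_enum xi) ?orbT.
have /boolp.choice[H HE] ij : exists P, map_mpoly e P = h ij.1 ij.2.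
  apply: cfP => x /(@mem_flatten_enum n _ (fun j => cf _ (h ij.1 j))) xi.
  have {}xi := @mem_flatten_enum n _ (fun i => flatten [seq cf _ (h i j) | j <- enum 'I_n]) ij.1 x xi.
  by rewrite !mem_cat xi !orbT.
have /boolp.choice[Q QE] i : exists a, e a = q i.
  by apply: Le; rewrite !mem_cat map_f ?orbT // mem_enum.
(* Evaluated at [(a, b)], the reduced certificate [H] writes [a i - b i] as a combination of
   zeros. *)
have injW a b : (forall i, mmap phi a (F i) = mmap phi b (F i)) -> a =1 b.
  move=> Fab i; pose u l := match split l with inl j => a j | inr j => b j end.
  have ul : u \o @lshift n n =1 a by move=> j; rewrite /u /= (unsplitK (inl j)).
  have ur : u \o @rshift n n =1 b by move=> j; rewrite /u /= (unsplitK (inr j)).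
  pose G := 'X_(lshift n i) - 'X_(rshift n i) -
    \sum_j H (i, j) * (mrename (@lshift n n) A (F j) - mrename (@rshift n n) A (F j)).
  have /(ker_mmap u ker) : map_mpoly e G = 0.
    apply/eqP; rewrite rmorphB subr_eq0 rmorphB /= !map_mpolyX hE rmorph_sum.
    apply/eqP/eq_bigr => j _.
    by rewrite rmorphM rmorphB /= !map_mpoly_rename FE HE.
  rewrite rmorphB rmorphB /= !mmapXU rmorph_sum big1 => [/eqP|j _].
    by rewrite subr0 -[u _]/((u \o @lshift n n) i) -[X in _ - X]/((u \o @rshift n n) i) ul ur subr_eq0 => /eqP.
  by rewrite rmorphM rmorphB /= !mmap_rename (eq_mmap _ ul) (eq_mmap _ ur) Fab subrr mulr0.
have noW v : exists i, mmap phi v (F i) != phi (Q i).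
  apply: boolp.contrapT => nov.
  pose K := 1 - \sum_i S i * (F i - (Q i)%:MP).
  have /(ker_mmap v ker) : map_mpoly e K = 0.
    apply/eqP; rewrite rmorphB subr_eq0 rmorph1 sE rmorph_sum; apply/eqP/eq_bigr => j _.
    by rewrite rmorphM rmorphB /= map_mpolyC FE SE /= QE.
  rewrite rmorphB rmorph1 rmorph_sum big1 => [/eqP|j _]; first by rewrite subr0 oner_eq0.
  rewrite rmorphM rmorphB /= mmapC; apply/eqP; rewrite mulf_eq0; apply/orP; right.
  by rewrite subr_eq0; apply/negPn/negP => ?; apply: nov; exists j.
(* [T] is a finite ring containing the reduced coefficients and right-hand sides, so [F] maps [T^n]
   to itself injectively, hence onto, against [noW]. *)
have [T [tT T1 TB TM]] := Wfin (flatten [seq [seq phi (F j)@_m | m <- msupp (F j)] | j <- enum 'I_n]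
  ++ [seq phi (Q j) | j <- enum 'I_n]).
have T0 : 0 \in T by rewrite -(subrr 1) TB.
have TD x y : x \in T -> y \in T -> x + y \in T.
  by move=> xT yT; rewrite -[y]opprK TB // -[- y]sub0r TB.
have TX x d : x \in T -> x ^+ d \in T.
  by move=> xT; elim: d => // d IHd; rewrite exprS TM.
have FT (v : {ffun 'I_n -> seq_sub T}) i : mmap phi (fun j => ssval (v j)) (F i) \in T.
  rewrite /mmap big_seq; apply: (big_ind (fun x => x \in T)) => // m mi; apply: (TM).
    by apply: tT; rewrite mem_cat (mem_flatten_enum (i := i)) //; apply/map_f.
  apply: (big_ind (fun x => x \in T)) => [//|x y xT yT|j _]; first exact: TM.
  exact/TX/ssvalP.
have QT i : phi (Q i) \in T.
  by apply: tT; rewrite mem_cat; apply/orP; right; apply/mapP; exists i; rewrite ?mem_enum.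
pose g (v : {ffun 'I_n -> seq_sub T}) := [ffun i => SeqSub (FT v i)].
have /injF_bij[g' _ gK] : injective g.
  move=> a b /ffunP gab; apply/ffunP => i; apply: val_inj.
  apply: (injW (fun j => ssval (a j)) (fun j => ssval (b j))) => j.
  by have := congr1 val (gab j); rewrite !ffunE.
pose qT := [ffun i => SeqSub (QT i)].
have [i /eqP[]] := noW (fun j => ssval (g' qT j)).
have /ffunP/(_ i) := gK qT; rewrite !ffunE => /(congr1 val) /=.
by [].
Qed.

(** * Rationality of the inverse *)

Section Functional.
Variables (A : comNzRingType) (B : idomainType) (iota : {rmorphism A -> B}).

(* A relation-respecting functional on the span of the [e l] with [e 0 |-> 0]    *)
(* and [e 1 |-> phi 1 != 0], with denominators cleared.                          *)
Lemma ex_functional_seq (e : nat -> B) (m : nat) :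
  (forall a0 a1, iota a0 * e 0%N + iota a1 * e 1%N = 0 -> iota a1 = 0) ->
  exists phi : nat -> A, [/\ iota (phi 0%N) = 0, iota (phi 1%N) != 0 &
    forall a : nat -> A, \sum_(l < m.+2) iota (a l) * e l = 0 ->
      \sum_(l < m.+2) iota (a l) * iota (phi l) = 0].
Proof.
move=> e01; elim: m => [|m [phi [phi0 phi1 phiP]]].
  exists (fun l => (l == 1)%:R); split; rewrite ?rmorph0 ?rmorph1 ?oner_eq0 //.
  move=> a; rewrite !big_ord_recl !big_ord0 /= !addr0 => /e01 ->.
  by rewrite rmorph0 mulr0 mul0r addr0.
set M := m.+2 in phiP *; have M1 : (1 < M)%N by [].
have M0 := ltnW M1; clearbody M.
have [[a [aM a0]]|noa] := boolp.pselect (exists a : nat -> A,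
    iota (a M) != 0 /\ \sum_(l < M.+1) iota (a l) * e l = 0); last first.
  exists (fun l => if (l < M)%N then phi l else 0); rewrite M0 M1; split => // b.
  have [bM|bM] := eqVneq (iota (b M)) 0; last by move=> b0; case: noa; exists b.
  rewrite !big_ord_recr /= bM !mul0r !addr0 => b0.
  by rewrite -[RHS](phiP b b0); apply: eq_bigr => l _; rewrite ltn_ord.
(* The relation [a] expresses [a M * e M] by earlier terms: the functional is scaled by [a M] and
   its value at [M] read off from [a]. For any other relation [b], the combination [c] eliminates
   [e M]. *)
exists (fun l => if (l < M)%N then a M * phi l else - \sum_(l < M) a l * phi l).
rewrite M0 M1; split; rewrite ?rmorphM ?phi0 ?mulr0 ?mulf_neq0 // => b b0.
pose c l := a M * b l - b M * a l.
have {}/(phiP c) : \sum_(l < M) iota (c l) * e l = 0.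
  move: a0 b0; rewrite !big_ord_recr /= => /eqP; rewrite addr_eq0 => /eqP a0.
  move=> /eqP; rewrite addr_eq0 => /eqP b0.
  under eq_bigr do rewrite /c rmorphB !rmorphM mulrBl -!mulrA.
  by rewrite sumrB -!mulr_sumr a0 b0; ring.
rewrite big_ord_recr /= ltnn => c0.
rewrite rmorphN mulrN rmorph_sum mulr_sumr -sumrB -[RHS]c0; apply: eq_bigr => l _.
by rewrite ltn_ord /c rmorphB !rmorphM; ring.
Qed.

(** The sequence consists of the monomials in [x] of degree less than [D], with [1] and [x i] put
    first; its relations are the polynomials vanishing at [x]. *)
Lemma ex_functional (n : nat) (x : 'I_n -> B) (i : 'I_n) (D : nat) : (1 < D)%N ->
  (forall a0 a1, iota a0 + iota a1 * x i = 0 -> iota a1 = 0) ->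
  exists psi : 'X_{1..n} -> A, [/\ iota (psi 0%MM) = 0, iota (psi U_(i)%MM) != 0 &
    forall P : {mpoly A[n]}, (msize P <= D)%N -> mmap iota x P = 0 ->
      \sum_(m : 'X_{1..n < D}) iota P@_m * iota (psi m) = 0].
Proof.
move=> D1 x01.
pose m0 : 'X_{1..n} := 0%MM; pose m1 : 'X_{1..n} := U_(i)%MM.
pose rest := [seq m <- [seq bmnm m | m <- enum {: 'X_{1..n < D}}] | (m != m0) && (m != m1)].
pose ms := [:: m0, m1 & rest].
have m10 : m1 != m0 by rewrite mnm1_eq0.
have m01 : m0 != m1 by rewrite eq_sym.
have ums : uniq ms.
  rewrite /= !inE (negPf m01) !mem_filter !eqxx andbF /= filter_uniq //.
  by rewrite map_inj_uniq ?enum_uniq //; apply: val_inj.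
have sumE (F : 'X_{1..n} -> B) : \sum_(m : 'X_{1..n < D}) F m = \sum_(l < size ms) F (nth m0 ms l).
  rewrite -(big_mkord xpredT (fun l => F (nth m0 ms l))) -(big_nth m0 xpredT F).
  rewrite -big_enum -(big_map (@bmnm n D) xpredT F).
  apply: perm_big; apply: uniq_perm => //.
    by rewrite map_inj_uniq ?enum_uniq //; apply: val_inj.
  have memD m : (m \in [seq bmnm m | m <- enum {: 'X_{1..n < D}}]) = (mdeg m < D)%N.
    apply/mapP/idP => [[m' _ ->]|mD]; first exact: bmdeg.
    by exists (BMultinom mD); rewrite ?mem_enum.
  move=> m; rewrite !inE mem_filter memD.
  have [->|] := eqVneq m m0; first by rewrite mdeg0 (ltn_trans _ D1).
  by have [->|] := eqVneq m m1; first by rewrite mdeg1 D1.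
have [|phi [phi0 phi1 phiP]] := @ex_functional_seq (fun l => mmap1 x (nth m0 ms l)) (size rest).
  by move=> a0 a1; rewrite /= mmap11 mmap1U mulr1; apply: x01.
exists (fun m => phi (index m ms)); split=> [||P PD].
- by rewrite /= eqxx.
- by rewrite /= (negPf m01) eqxx.
rewrite (mmapE D) // => P0.
rewrite (sumE (fun m => iota P@_m * iota (phi (index m ms)))).
under eq_bigr => l _ do rewrite index_uniq //.
apply: (phiP (fun l => P@_(nth m0 ms l))); rewrite -[RHS]P0.
by rewrite (sumE (fun m => iota P@_m * mmap1 x m)).
Qed.
End Functional.

(** If [x_i] is not a fraction in [f], then [1] and [x_i] are independent over [k[f]], and a
    [k[f]]-linear functional can vanish at [1] but not at [x_i]. Applied to the [y] side of the
    certificate, with the [x] side as scalars, it kills the right-hand side only. *)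
Lemma rational_inverse (k : fieldType) (n : nat)
    (f : 'I_n -> {mpoly k[n]}) (h : 'I_n -> 'I_n -> {mpoly k[n + n]}) :
  (forall i, 'X_(lshift n i) - 'X_(rshift n i) =
     \sum_j h i j * (mrename (@lshift n n) k (f j) - mrename (@rshift n n) k (f j))) ->
  forall i, exists P Q, mmap (@mpolyC n k) f Q != 0 /\
    mmap (@mpolyC n k) f Q * 'X_i = mmap (@mpolyC n k) f P.
Proof.
move=> hE i; apply: boolp.contrapT => norat.
pose B : idomainType := {mpoly k[n]}; pose X (j : 'I_n) : B := 'X_j.
pose iota : {rmorphism {mpoly k[n]} -> B} := mmap (@mpolyC n k) f.
pose theta : {rmorphism {mpoly k[n + n]} -> {mpoly B[n]}} :=
  mmap (@mpolyC n B \o @mpolyC n k)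
    (fun l => match split l with inl j => (X j)%:MP | inr j => 'X_j end).
have thetaX j : theta 'X_(lshift n j) = (X j)%:MP.
  by rewrite /theta /= mmapXU (unsplitK (inl j)).
have thetaY j : theta 'X_(rshift n j) = 'X_j.
  by rewrite /theta /= mmapXU (unsplitK (inr j)).
(* This is [z_j - f_j(y)], with indeterminates [z] for the values of [f]; it is a relation over
   [k[f]], as it vanishes at [z = f(x)], [y = x]. *)
pose T j : {mpoly {mpoly k[n]}[n]} := ('X_j)%:MP - map_mpoly (@mpolyC n k) (f j).
have thetaT j : theta (mrename (@lshift n n) k (f j) - mrename (@rshift n n) k (f j))
    = map_mpoly iota (T j).
  rewrite rmorphB [RHS]rmorphB /= map_mpolyC /= mmapXU; congr (_ - _).
    move: (f j); apply: (@eq_rmorph_mpoly _ _ _ (theta \o mrename (@lshift n n) k) (@mpolyC n B)).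
      by move=> c; rewrite /= !mmapC.
    by move=> l; rewrite /= mmapXU thetaX.
  move: (f j); apply: (@eq_rmorph_mpoly _ _ _ (theta \o mrename (@rshift n n) k)
     (map_mpoly iota \o map_mpoly (@mpolyC n k))).
    by move=> c; rewrite /= !mmapC !map_mpolyC /= mmapC.
  by move=> l; rewrite /= mmapXU thetaY !map_mpolyX.
have T0 j : mmap iota X (T j) = 0.
  rewrite rmorphB /= mmapC /= mmapXU; apply/eqP; rewrite subr_eq0; apply/eqP.
  move: (f j); apply: (@eq_rmorph_mpoly _ _ _ idfun (mmap iota X \o map_mpoly (@mpolyC n k))).
    by move=> c; rewrite /= map_mpolyC mmapC /= mmapC.
  by move=> l; rewrite /= map_mpolyX mmapXU.
(* [D] bounds the size of each monomial of [theta (h i j)] times [T j]; the summand 2 makes room for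
   [1] and [x_i]. *)
pose D := (2 + \max_j (msize (theta (h i j)) + msize (T j)))%N.
have DP j m : m \in msupp (theta (h i j)) -> (msize ('X_[m] * T j)%R <= D)%N.
  move=> /msize_mdeg_lt mj; apply: leq_trans (msizeM_le _ _) _.
  rewrite msizeX; apply: (@leq_trans (msize (theta (h i j)) + msize (T j)).+1%N).
    by rewrite ltnS leq_add2r.
  apply: leq_trans (leq_addl 1 _); rewrite ltnS.
  exact: (leq_bigmax (F := fun j => (msize (theta (h i j)) + msize (T j))%N)).
have [||psi [psi0 psi1 psiP]] := @ex_functional _ B iota n X i D.
- exact: leq_addr.
- move=> a0 a1 /eqP; rewrite addrC addr_eq0 -rmorphN => /eqP aE.
  by apply/eqP/negPn/negP => a10; apply: norat; exists (- a0), a1.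
(* [Phi] is [B]-linear and kills every multiple of [f_j(x) - f_j(y)], hence       *)
(* [x_i - y_i], although it maps the latter to [- iota (psi U_(i))].             *)
pose Phi (p : {mpoly B[n]}) := \sum_(m : 'X_{1..n < D}) p@_m * iota (psi m).
have PhiD p q : Phi (p + q) = Phi p + Phi q.
  by rewrite /Phi -big_split; apply: eq_bigr => m _; rewrite mcoeffD mulrDl.
have PhiZ c p : Phi (c *: p) = c * Phi p.
  by rewrite /Phi mulr_sumr; apply: eq_bigr => m _; rewrite mcoeffZ mulrA.
have Phi0 : Phi 0 = 0 by rewrite -(scale0r 0) PhiZ mul0r.
have PhiS (I : Type) (r : seq I) (G : I -> {mpoly B[n]}) :
    Phi (\sum_(j <- r) G j) = \sum_(j <- r) Phi (G j).
  by apply: (big_morph Phi PhiD Phi0).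
have PhiX m c : (mdeg m < D)%N -> Phi (c *: 'X_[m]) = c * iota (psi m).
  move=> mD; rewrite PhiZ /Phi (bigD1 (BMultinom mD)) //= mcoeffX eqxx mul1r big1 ?addr0 // => m' m'm.
  by rewrite mcoeffX (_ : m == m' = false) ?mul0r //; apply: contraNF m'm => /eqP mm'; rewrite bmeqP /= mm'.
have /(congr1 theta) := hE i; rewrite rmorphB thetaX thetaY rmorph_sum => /(congr1 Phi).
rewrite PhiS big1 => [|j _]; last first.
  rewrite rmorphM thetaT [theta (h i j)]mpolyE mulr_suml PhiS big_seq big1 // => m mj.
  rewrite -scalerAl PhiZ (_ : 'X_[m] * _ = map_mpoly iota ('X_[m] * T j)); last first.
    by rewrite rmorphM /= map_mpolyX.
  rewrite /Phi; under eq_bigr do rewrite mcoeff_map_mpoly.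
  rewrite psiP ?DP ?mulr0 // rmorphM; apply/eqP; rewrite mulf_eq0.
  by apply/orP; right; apply/eqP/T0.
rewrite -[(X i)%:MP]mulr1 mul_mpolyC -mpolyX0 PhiD -scaleN1r !PhiX ?mdeg0 ?mdeg1 //.
by rewrite psi0 mulr0 add0r mulN1r => /eqP; rewrite oppr_eq0 (negPf psi1).
Qed.

(** * Divisibility along lines *)

(** Expansions with remainder a multiple of [t ^+ 2] are stable under sums and products. *)
Lemma mmap_taylor (k R : comNzRingType) (n : nat) (e : {rmorphism k -> R})
    (x w : 'I_n -> R) (t : R) (p : {mpoly k[n]}) :
  exists c, mmap e (fun i => x i + t * w i) p =
    mmap e x p + t * (\sum_i mmap e x p^`M(i) * w i) + t ^+ 2 * c.
Proof.
elim/mpoly_alg_ind: p => [c|i|p q [c pE] [d qE]|p q [c pE] [d qE]].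
- exists 0; rewrite !mmapC big1 ?mulr0 ?addr0 // => i _.
  by rewrite mderivC mmap0 mul0r.
- exists 0; rewrite !mmapXU mulr0 addr0 (bigD1 i) //= big1 ?addr0 => [|j ji].
    rewrite mderivX mnm1E eqxx scale1r (_ : (_ - _)%MM = 0%MM) ?mpolyX0 ?rmorph1 ?mul1r //.
    by apply/mnmP => j; rewrite mnmBE subnn mnm0E.
  by rewrite mderivX mnm1E eq_sym (negPf ji) scale0r mmap0 mul0r.
- exists (c + d); rewrite !rmorphD /= pE qE.
  under eq_bigr do rewrite mderivD rmorphD /= mulrDl.
  by rewrite big_split /=; ring.
- set Sp := \sum_i mmap e x p^`M(i) * w i in pE.
  set Sq := \sum_i mmap e x q^`M(i) * w i in qE.
  set P := mmap e x p in pE *; set Q := mmap e x q in qE *.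
  have -> : \sum_i mmap e x (p * q)^`M(i) * w i = Sp * Q + P * Sq.
    rewrite /Sp /Sq mulr_suml mulr_sumr -big_split; apply: eq_bigr => i _.
    by rewrite mderivM rmorphD /= !rmorphM /= -/P -/Q; ring.
  exists (Sp * Sq + P * d + c * Q + t * (Sp * d + Sq * c) + t ^+ 2 * c * d).
  by rewrite !rmorphM /= pE qE; ring.
Qed.

Lemma mmap_congr (k R : comNzRingType) (n : nat) (e : {rmorphism k -> R})
    (x w : 'I_n -> R) (t : R) (p : {mpoly k[n]}) :
  exists c, mmap e (fun i => x i + t * w i) p = mmap e x p + t * c.
Proof.
have [c ->] := mmap_taylor e x w t p.
by exists (\sum_i mmap e x p^`M(i) * w i + t * c); ring.
Qed.

(** Starting from the constant curve [a], each step gains one order in the agreement of [f(g)] with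
    [l] at [s0]. *)
Lemma newton_lift (k : fieldType) (n : nat) (f : 'I_n -> {mpoly k[n]}) (c : k)
    (l : 'I_n -> {poly k}) (s0 : k) (a : 'I_n -> k) (N : nat) :
  c != 0 -> \det (\matrix_(i, j) (f i)^`M(j)) = c%:MP ->
  (forall i, (f i).@[a] = (l i).[s0]) ->
  exists g w : 'I_n -> {poly k},
    forall i, mmap polyC g (f i) = l i + ('X - s0%:P) ^+ N.+1 * w i.
Proof.
move=> c0 detJ fa; set t := 'X - s0%:P.
elim: N => [|N [g [w gw]]].
  exists (fun i => (a i)%:P).
  suff /boolp.choice[w ?] : forall i, exists wi,
    mmap polyC (fun j => (a j)%:P) (f i) = l i + t ^+ 1 * wi by exists w.
  move=> i.
  have : root ((f i).@[a]%:P - l i) s0 by rewrite rootE !hornerE fa subrr.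
  move=> /factor_theorem[wi wE]; exists wi; rewrite expr1 mulrC -wE addrC subrK.
  by rewrite rmorph_mmap.
pose ev : {rmorphism {mpoly k[n]} -> {poly k}} := mmap polyC g.
pose J := map_mx ev (\matrix_(i, j) (f i)^`M(j)).
(* [u] solves [J u = - w], so that the linear Taylor term cancels the error. *)
pose u := - (c^-1)%:P *: (\adj J *m \col_i w i).
have Ju i : \sum_j ev (f i)^`M(j) * u j 0 = - w i.
  have : (J *m u) i 0 = - w i.
    rewrite /u -scalemxAr mulmxA mul_mx_adj det_map_mx detJ /= mmapC mul_scalar_mx.
    by rewrite !mxE mulrA -polyCN -polyCM mulNr mulVf // polyCN mulN1r.
  by rewrite mxE => <-; apply: eq_bigr => j _; rewrite !mxE.
(* The inverse of the Jacobian matrix along [g] is polynomial: its determinant   *)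
(* is the constant [c].                                                          *)
exists (fun i => g i + t ^+ N.+1 * u i 0).
suff /boolp.choice[w' ?] : forall i, exists wi,
  mmap polyC (fun j => g j + t ^+ N.+1 * u j 0) (f i) = l i + t ^+ N.+2 * wi by exists w'.
move=> i.
have [d ->] := mmap_taylor polyC g (fun i => u i 0) (t ^+ N.+1) (f i).
(* The Taylor remainder has order [2 (N + 1) = (N + 2) + N]. *)
exists (t ^+ N * d); rewrite Ju gw mulrN addrK; congr (_ + _).
by rewrite -exprM mulrA -exprD addSnnS addnn -muln2.
Qed.

(** Write [Q = Q' * gcd(Q, P)]. If [Q'] had a root [s], of multiplicity [m] in [Q], the hypothesis
    at order [m] would make [('X - s)^m] divide the gcd, hence [('X - s)^(m + 1)] divide [Q]. *)
Lemma dvdp_local (k : closedFieldType) (P Q : {poly k}) : Q != 0 ->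
  (forall s N, exists y z, P = Q * y + ('X - s%:P) ^+ N * z) -> Q %| P.
Proof.
move=> Q0 loc; have /dvdpP[Q' QE] := dvdp_gcdl Q P.
have [szQ'|/closed_rootP[s]] := boolP (size Q' == 1%N).
  have /size_poly1P[c c0 Q'c] := szQ'.
  by rewrite QE Q'c mul_polyC dvdpZl // dvdp_gcdr.
rewrite -dvdp_XsubCl => sQ'.
have [m [q]] := multiplicity_XsubC Q s; rewrite Q0 /= => qs QqE.
have [y [z PE]] := loc s m.
have mQ : ('X - s%:P) ^+ m %| Q by rewrite QqE dvdp_mull.
have : ('X - s%:P) ^+ m %| gcdp Q P.
  by rewrite dvdp_gcd mQ PE dvdp_add // ?dvdp_mulr.
move=> /(dvdp_mul sQ'); rewrite -QE QqE dvdp_mul2r ?dvdp_XsubCl ?(negPf qs) //.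
by rewrite expf_neq0 // polyXsubC_eq0.
Qed.

(** Surjectivity gives a point above [l(s)], and Newton iteration a curve [g] with [f(g)] close to
    [l] near [s]. Substituting [g] in [Q(f) y = P(f)] gives [P(l) = Q(l) y(g)] to any order at
    [s]. *)
Lemma dvdp_along_curve (k : closedFieldType) (n : nat) (f : 'I_n -> {mpoly k[n]})
    (c : k) (P Q y : {mpoly k[n]}) (l : 'I_n -> {poly k}) :
  c != 0 -> \det (\matrix_(i, j) (f i)^`M(j)) = c%:MP ->
  (forall q : 'I_n -> k, exists v, forall i, (f i).@[v] = q i) ->
  mmap (@mpolyC n k) f Q * y = mmap (@mpolyC n k) f P ->
  mmap polyC l Q != 0 -> mmap polyC l Q %| mmap polyC l P.
Proof.
move=> c0 detJ surj QyP Ql0; apply: dvdp_local => // s N.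
have [a fa] := surj (fun i => (l i).[s]).
have [g [w gw]] := newton_lift N c0 detJ fa.
have fgE p : mmap polyC g (mmap (@mpolyC n k) f p) =
    mmap polyC (fun i => l i + ('X - s%:P) ^+ N.+1 * w i) p.
  rewrite rmorph_mmap; move: p; apply: eq_rmorph_mpoly => [d|i] /=.
    by rewrite !mmapC /= mmapC.
  by rewrite !mmapXU /= gw.
have := congr1 (mmap polyC g) QyP; rewrite rmorphM /= !fgE.
have [p1 ->] := mmap_congr polyC l w (('X - s%:P) ^+ N.+1) P.
have [q1 ->] := mmap_congr polyC l w (('X - s%:P) ^+ N.+1) Q.
move=> /esym/(canRL (addrK _)) ->.
exists (mmap polyC g y), (('X - s%:P) * (q1 * mmap polyC g y - p1)).
by rewrite exprSr; ring.
Qed.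

Lemma coefM_top (R : nzRingType) (p q : {poly R}) a b :
  (size p <= a.+1)%N -> (size q <= b.+1)%N -> (p * q)`_(a + b) = p`_a * q`_b.
Proof.
move=> pa qb; have ab : (a < (a + b).+1)%N by rewrite ltnS leq_addr.
rewrite coefM (bigD1 (Ordinal ab)) //= addKn big1 ?addr0 // => i ia.
have [ia'|ai] := ltnP i a.
  rewrite [q`__]nth_default ?mulr0 // (leq_trans qb) //; lia.
rewrite nth_default ?mul0r // (leq_trans pa) // ltn_neqAle ai andbT.
by rewrite eq_sym; apply: contra ia => /eqP ?; apply/eqP/val_inj.
Qed.

Section AlongLines.
Variables (k : comNzRingType) (n : nat) (v : 'I_n -> k).

(** The restriction [p(x + T v)] of [p] to the line of direction [v] through the generic point
    [x]. *)
Definition along : {rmorphism {mpoly k[n]} -> {poly {mpoly k[n]}}} :=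
  mmap (@polyC {mpoly k[n]} \o @mpolyC n k) (fun i => ('X_i)%:P + ((v i)%:MP)%:P * 'X).

Lemma along0 p : (along p).[0] = p.
Proof.
move: p; apply: (@eq_rmorph_mpoly _ _ _ (horner_eval 0 \o along) idfun) => [c|i].
  by rewrite /along /= mmapC /= /horner_eval hornerC.
by rewrite /along /= mmapXU /horner_eval !hornerE.
Qed.

Lemma map_along a p :
  map_poly (meval a) (along p) = mmap polyC (fun i => (a i)%:P + (v i)%:P * 'X) p.
Proof.
move: p; apply: (@eq_rmorph_mpoly _ _ _ (map_poly (meval a) \o along)) => [c|i].
  by rewrite /along /= !mmapC /= map_polyC /= mevalC.
by rewrite /along /= !mmapXU rmorphD rmorphM /= !map_polyC map_polyX /= mevalXU mevalC.
Qed.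

Lemma along_top m : (size (along 'X_[m]) <= (mdeg m).+1)%N /\
  (along 'X_[m])`_(mdeg m) = ('X_[m] : {mpoly k[n]}).@[v]%:MP.
Proof.
rewrite mpolyXE_id rmorph_prod rmorph_prod mdegE /=.
pose K (d : nat) (p : {poly {mpoly k[n]}}) (c : k) := (size p <= d.+1)%N /\ p`_d = c%:MP.
have K1 : K 0%N 1 1 by rewrite /K size_poly1 coef1.
have KM d1 d2 p1 p2 c1 c2 : K d1 p1 c1 -> K d2 p2 c2 -> K (d1 + d2)%N (p1 * p2) (c1 * c2).
  move=> [s1 e1] [s2 e2]; split; last by rewrite coefM_top // e1 e2 mpolyCM.
  by have := size_polyMleq p1 p2; lia.
apply: (big_ind3 K) => [//|? ? ? ? ? ?|i _]; first exact: (KM).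
rewrite !rmorphXn /= mevalXU /along /= mmapXU.
elim: {m}(m i) => [|d IHd]; first by rewrite !expr0.
rewrite !exprS -add1n; apply: KM => //; split; last first.
  by rewrite coefD coefC coefCM coefX /= add0r mulr1.
by rewrite (leq_trans (size_polyD _ _)) // geq_max (leq_trans (size_polyC_leq1 _)) //=
  (leq_trans (size_polyMleq _ _)) // size_polyX addnC /= ltnS size_polyC_leq1.
Qed.
End AlongLines.

(** The coefficient of [T^(deg Q)] in [Q(x + T v)] is the top homogeneous part of [Q] at [v], free
    of [x]; [v] is chosen outside its zeros. *)
Lemma along_lead (k : closedFieldType) (n : nat) (Q : {mpoly k[n]}) : Q != 0 ->
  exists (v : 'I_n -> k) (c : k), c != 0 /\ lead_coef (along v Q) = c%:MP.
Proof.
move=> Q0; pose d := mdeg (mlead Q).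
have mQd m : m \in msupp Q -> (mdeg m <= d)%N.
  by move=> /msize_mdeg_lt; rewrite -(mlead_deg Q0) ltnS.
pose T := \sum_(m <- msupp Q | mdeg m == d) Q@_m *: 'X_[m].
have /mpoly_nonroot[v Tv] : T != 0.
  have /eqP TQ : T@_(mlead Q) == Q@_(mlead Q).
    rewrite raddf_sum /= -big_filter (bigD1_seq (mlead Q)) ?filter_uniq ?mem_filter ?mlead_supp ?eqxx //=.
    rewrite mcoeffZ mcoeffX eqxx mulr1 big1 ?addr0 // => m mQ.
    by rewrite mcoeffZ mcoeffX (negPf mQ) mulr0.
  by apply: contraNneq Q0 => T0; rewrite -mleadc_eq0 -TQ T0 mcoeff0.
exists v, T.@[v]; split => //.
have QE : along v Q = \sum_(m <- msupp Q) (Q@_m)%:MP%:P * along v 'X_[m].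
  rewrite {1}[Q]mpolyE rmorph_sum; apply: eq_bigr => m _.
  by rewrite -mul_mpolyC rmorphM /along /= mmapC.
have szQ : (size (along v Q) <= d.+1)%N.
  rewrite QE big_seq; apply: leq_trans (size_sum _ _ _) _; apply/bigmax_leqP_seq => m mQ _.
  have [sm _] := along_top v m; have dm := mQd m mQ.
  apply: leq_trans (size_polyMleq _ _) _; rewrite -subn1 leq_subLR.
  by apply: leq_add; [exact: size_polyC_leq1|exact: leq_trans sm _].
have coefd : (along v Q)`_d = T.@[v]%:MP.
  rewrite QE coef_sum /T (raddf_sum (meval v)) (raddf_sum (@mpolyC n k)) /= [RHS]big_mkcond /= !big_seq.
  apply: eq_bigr => m mQ; rewrite coefCM; have [sm tm] := along_top v m.
  have [md|md] := eqVneq (mdeg m) d; first by rewrite -md tm mevalZ mpolyCM.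
  by rewrite nth_default ?mulr0 // (leq_trans sm) // ltn_neqAle md mQd.
suff szE : size (along v Q) = d.+1 by rewrite lead_coefE szE.
apply/eqP; rewrite eqn_leq szQ ltnNge; apply: contra Tv => /(nth_default 0).
by rewrite coefd => /eqP; rewrite mpolyC_eq0.
Qed.

(** Specialization at [a] keeps the degree of [E], so the remainder of the pseudo-division of [G] by
    [E], divisible by [E] at [a] and of smaller degree, vanishes there. *)
Lemma dvdp_pointwise (k : closedFieldType) (n : nat) (E G : {poly {mpoly k[n]}}) (c : k) :
  c != 0 -> lead_coef E = c%:MP ->
  (forall a, map_poly (meval a) E %| map_poly (meval a) G) ->
  exists W, G = E * W.
Proof.
move=> c0 lcE dvdE; have := Pdiv.ComRing.rdivp_eq E G.
set N := Pdiv.Ring.rscalp _ _; set S := Pdiv.Ring.rdivp _ _; set R := Pdiv.Ring.rmodp _ _.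
have szR : (size R < size E)%N.
  by rewrite Pdiv.Ring.ltn_rmodp -lead_coef_eq0 lcE mpolyC_eq0.
rewrite lcE => GE.
have R0 : R = 0.
  apply/polyP => i; rewrite coef0; apply: mpoly_eval_inj => a.
  rewrite meval0 -coef_map.
  suff -> : map_poly (meval a) R = 0 by rewrite coef0.
  have szE : size (map_poly (meval a) E) = size E.
    by rewrite size_map_poly_id0 // lcE mevalC.
  have : map_poly (meval a) E %| map_poly (meval a) R.
    have := congr1 (map_poly (meval a)) GE.
    rewrite map_polyZ rmorphD rmorphM /= => /(canLR (addKr _)) <-.
    apply: dvdp_add; first by rewrite -mulNr dvdp_mulIr.
    by rewrite -mul_polyC; apply: dvdp_mull.
  apply: contraTeq => Ra0; apply/negP => /(dvdp_leq Ra0); rewrite szE leqNgt.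
  by rewrite (leq_ltn_trans _ szR) // size_poly.
exists ((c^-1 ^+ N)%:MP *: S); rewrite -scalerAr [E * S]mulrC.
rewrite -[S * E]addr0 -R0 -GE scalerA -rmorphXn -rmorphM /= -exprMn mulVf //.
by rewrite expr1n mpolyC1 scale1r.
Qed.

(** In a direction [v] with constant leading coefficient, [Q] is nonzero on every line; so
    [Q(x + T v)] divides [P(x + T v)] over [k[x]], and [T] is set to 0. *)
Lemma dvd_along_lines (k : closedFieldType) (n : nat) (P Q : {mpoly k[n]}) : Q != 0 ->
  (forall a v : 'I_n -> k, let l i := (a i)%:P + (v i)%:P * 'X in
     mmap polyC l Q != 0 -> mmap polyC l Q %| mmap polyC l P) ->
  exists W, P = Q * W.
Proof.
move=> Q0 dvdl; have [v [c [c0 lcQ]]] := along_lead Q0.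
have [a|W PE] := dvdp_pointwise (G := along v P) c0 lcQ.
  have := dvdl a v; rewrite /= -(map_along v a P) -(map_along v a Q); apply.
  rewrite -lead_coef_eq0 lead_coef_map_eq ?lcQ /= mevalC //.
by exists W.[0]; rewrite -[LHS](along0 v) PE hornerM along0.
Qed.

(** * The Bezoutian *)

Section GeneratedIdealTheory.
Variables (R : comNzRingType) (m : nat) (g : m.-tuple R).

Lemma genideal_mull (a p : R) : p \in genideal g -> a * p \in genideal g.
Proof.
move=> /genidealP[b ->]; apply/genidealP; exists (fun i => a * b i).
by rewrite mulr_sumr; apply: eq_bigr => i _; rewrite mulrA.
Qed.

Lemma genideal_gen i : tnth g i \in genideal g.
Proof.
apply/genidealP; exists (fun j => (j == i)%:R).
rewrite (bigD1 i) //= eqxx mul1r big1 ?addr0 // => j ji.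
by rewrite (negPf ji) mul0r.
Qed.

Lemma genideal_rmorph0 (S : comNzRingType) (phi : {rmorphism R -> S}) p :
  (forall i, phi (tnth g i) = 0) -> p \in genideal g -> phi p = 0.
Proof.
move=> phi0 /genidealP[a ->]; rewrite rmorph_sum big1 // => i _.
by rewrite rmorphM phi0 mulr0.
Qed.

(** The polynomials on which [phi] and [psi] agree modulo the ideal form a subalgebra. *)
Lemma genideal_rmorphB (n : nat) (k : comNzRingType) (phi psi : {rmorphism {mpoly k[n]} -> R}) p :
  (forall c, phi c%:MP = psi c%:MP) ->
  (forall i, phi 'X_i - psi 'X_i \in genideal g) -> phi p - psi p \in genideal g.
Proof.
move=> phiC phiX; elim/mpoly_alg_ind: p => // [c|p q pI qI|p q pI qI].
- by rewrite phiC subrr rpred0.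
- by rewrite !rmorphD opprD addrACA rpredD.
rewrite !rmorphM; have -> : phi p * phi q - psi p * psi q =
    phi q * (phi p - psi p) + psi p * (phi q - psi q) by ring.
by rewrite rpredD // genideal_mull.
Qed.
End GeneratedIdealTheory.

Section BezoutianTheory.
Variables (k : fieldType) (n : nat).
Implicit Types f : n.-tuple {mpoly k[n]}.

Definition pairpt (T : Type) (a b : 'I_n -> T) (l : 'I_(n + n)) : T :=
  match split l with inl i => a i | inr i => b i end.

Lemma pairpt_lshift T (a b : 'I_n -> T) i : pairpt a b (lshift n i) = a i.
Proof. by rewrite /pairpt (unsplitK (inl i)). Qed.

Lemma pairpt_rshift T (a b : 'I_n -> T) i : pairpt a b (rshift n i) = b i.
Proof. by rewrite /pairpt (unsplitK (inr i)). Qed.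

Lemma pairptE T (u : 'I_(n + n) -> T) :
  pairpt (fun i => u (lshift n i)) (fun i => u (rshift n i)) =1 u.
Proof. by move=> l; rewrite /pairpt; case: splitP => i li; congr u; apply: val_inj. Qed.

Lemma mmap_comp_mpoly (R : comNzRingType) (e : {rmorphism k -> R}) N (u : 'I_N -> R)
    (s : n.-tuple {mpoly k[N]}) p :
  mmap e u (p \mPo s) = mmap e (fun i => mmap e u (tnth s i)) p.
Proof.
rewrite /comp_mpoly rmorph_mmap; move: p; apply: eq_rmorph_mpoly => [c|i] /=.
  by rewrite !mmapC /= mmapC.
by rewrite !mmapXU.
Qed.

Lemma comp_xvars (p : {mpoly k[n]}) : p \mPo xvars k n = mrename (@lshift n n) k p.
Proof. by apply: eq_mmap => i; rewrite tnth_mktuple. Qed.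

Lemma comp_yvars (p : {mpoly k[n]}) : p \mPo yvars k n = mrename (@rshift n n) k p.
Proof. by apply: eq_mmap => i; rewrite tnth_mktuple. Qed.

(** The numerators telescope from the point [x] at [j = 0] to the point [y] at [j = n]. *)
Lemma sum_Delta f i : \sum_j Delta f i j * (Xvar k j - Yvar k j) =
  (tnth f i \mPo xvars k n) - (tnth f i \mPo yvars k n).
Proof.
under eq_bigr do rewrite DeltaE /Delta_num.
have := telescope_sumr (fun j => - (tnth f i \mPo yxvars k n j)) (leq0n n).
rewrite big_mkord opprK addrC => tE.
have -> : xvars k n = yxvars k n 0 by apply: eq_from_tnth => j; rewrite !tnth_mktuple.
have -> : yvars k n = yxvars k n n.
  by apply: eq_from_tnth => j; rewrite !tnth_mktuple ltn_ord.
by rewrite -tE; apply: eq_bigr => j _; rewrite opprK addrC.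
Qed.

(** The matrix of divided differences sends the vector [x - y] to [f(x) - f(y)]; its adjugate then
    brings out the determinant. *)
Lemma Bez_mulB f : exists h : 'I_n -> 'I_n -> {mpoly k[n + n]},
  forall j, Bez f * (Xvar k j - Yvar k j) =
    \sum_i h j i * ((tnth f i \mPo xvars k n) - (tnth f i \mPo yvars k n)).
Proof.
pose D := \matrix_(i, j) Delta f i j.
pose d : 'cV_n := \col_(j < n) (Xvar k j - Yvar k j).
exists (fun j i => (\adj D) j i) => j.
have : (\adj D *m (D *m d)) j 0 = Bez f * (Xvar k j - Yvar k j).
  by rewrite mulmxA mul_adj_mx mul_scalar_mx !mxE.
move=> <-; rewrite mxE; apply: eq_bigr => i _; congr (_ * _).
by rewrite -sum_Delta mxE; apply: eq_bigr => l _; rewrite !mxE.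
Qed.

(* Restrict to [y = a], [x = a + 'X e_j], where [Delta] becomes a difference     *)
(* quotient.                                                                     *)
Lemma Delta_diag f i j (a : 'I_n -> k) :
  (Delta f i j).@[pairpt a a] = ((tnth f i)^`M(j)).@[a].
Proof.
pose rho : {rmorphism {mpoly k[n + n]} -> {poly k}} :=
  mmap polyC (pairpt (fun l => (a l)%:P + 'X * ((l == j)%:R)%:P) (fun l => (a l)%:P)).
have rhoX l : rho (Xvar k l) = (a l)%:P + 'X * ((l == j)%:R)%:P.
  by rewrite /rho /= mmapXU pairpt_lshift.
have rhoY l : rho (Yvar k l) = (a l)%:P by rewrite /rho /= mmapXU pairpt_rshift.
(* [rho] separates [x_l] from [y_l] for [l = j] only, so the two points in [Delta_num] become
   [a + 'X e_j] and [a]. *)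
have rho1 : rho (tnth f i \mPo yxvars k n j) =
    mmap polyC (fun l => (a l)%:P + 'X * ((l == j)%:R)%:P) (tnth f i).
  rewrite /rho /= mmap_comp_mpoly; apply: eq_mmap => l.
  rewrite tnth_mktuple; case: ltnP => lj; rewrite -/(rho _) ?rhoX ?rhoY //.
  by rewrite -val_eqE /= ltn_eqF // mulr0 addr0.
have rho2 : rho (tnth f i \mPo yxvars k n j.+1) = mmap polyC (fun l => (a l)%:P) (tnth f i).
  rewrite /rho /= mmap_comp_mpoly; apply: eq_mmap => l.
  rewrite tnth_mktuple ltnS; case: leqP => lj; rewrite -/(rho _) ?rhoX ?rhoY //.
  by rewrite -val_eqE /= gtn_eqF // mulr0 addr0.
have [c cE] := mmap_taylor polyC (fun l => (a l)%:P) (fun l => ((l == j)%:R)%:P) 'X (tnth f i).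
have : rho (Delta f i j) * 'X = (((tnth f i)^`M(j)).@[a]%:P + 'X * c) * 'X.
  have := congr1 rho (DeltaE f i j).
  rewrite /Delta_num rmorphM !rmorphB rhoX rhoY eqxx rho1 rho2 [_ + 'X * _]addrC addrK mulr1.
  move=> ->; rewrite cE (bigD1 j) //= eqxx mulr1 big1 ?addr0 => [|l lj]; last first.
    by rewrite (negPf lj) mulr0.
  rewrite [mmap polyC _ _^`M(j)](_ : _ = ((tnth f i)^`M(j)).@[a]%:P); first by ring.
  by rewrite /meval rmorph_mmap.
move=> /(mulIf (negbT (polyX_eq0 _))) /(congr1 (horner_eval 0)).
rewrite /horner_eval !hornerE => <-.
rewrite -[RHS]/((horner_eval 0 \o rho) (Delta f i j)).
move: (Delta f i j) => p; move: p; apply: eq_rmorph_mpoly => [d|l].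
  by rewrite /= mevalC mmapC /horner_eval hornerC.
rewrite /= mevalXU mmapXU /horner_eval /pairpt; case: split => l'; rewrite !hornerE //.
Qed.

Lemma Bez_diag f (a : 'I_n -> k) : (Bez f).@[pairpt a a] = (Jac f).@[a].
Proof.
rewrite /Bez /Jac -!det_map_mx; congr (\det _); apply/matrixP => i j.
by rewrite !mxE; apply: Delta_diag.
Qed.

Lemma Jac_pm_sub f q : Jac (pm_sub f q) = Jac f.
Proof.
congr (\det _); apply/matrixP => i j; rewrite !mxE tnth_mktuple.
by rewrite mderivB mderivC subr0.
Qed.

Lemma meval_xvars (p : {mpoly k[n]}) a b : (p \mPo xvars k n).@[pairpt a b] = p.@[a].
Proof.
rewrite comp_mpoly_meval; apply: meval_eq => i.
by rewrite tnth_mktuple mevalXU pairpt_lshift.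
Qed.

Lemma meval_yvars (p : {mpoly k[n]}) a b : (p \mPo yvars k n).@[pairpt a b] = p.@[b].
Proof.
rewrite comp_mpoly_meval; apply: meval_eq => i.
by rewrite tnth_mktuple mevalXU pairpt_rshift.
Qed.

Lemma Bez_eq0 f (a b : 'I_n -> k) i :
  (forall j, (tnth f j).@[a] = (tnth f j).@[b]) -> a i != b i ->
  (Bez f).@[pairpt a b] = 0.
Proof.
move=> fab abi; have [h hE] := Bez_mulB f.
have : (\sum_j h i j * ((tnth f j \mPo xvars k n) - (tnth f j \mPo yvars k n))).@[pairpt a b] = 0.
  apply: (big_ind (fun p => p.@[pairpt a b] = 0)) => [|p p' p0 p'0|j _]; first exact: meval0.
    by rewrite mevalD p0 p'0 addr0.
  by rewrite mevalM mevalB meval_xvars meval_yvars fab subrr mulr0.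
rewrite -hE mevalM mevalB !mevalXU pairpt_lshift pairpt_rshift.
by move=> /eqP; rewrite mulf_eq0 subr_eq0 (negPf abi) orbF => /eqP.
Qed.

Lemma bez_gens_meval f a b l : (forall j, (tnth f j).@[a] = 0) ->
  (forall j, (tnth f j).@[b] = 0) -> (tnth (bez_gens f) l).@[pairpt a b] = 0.
Proof.
move=> fa fb; rewrite -[l]splitK; case: (split l) => i /=.
  by rewrite tnth_lshift tnth_mktuple meval_xvars.
by rewrite tnth_rshift tnth_mktuple meval_yvars.
Qed.

(** For [q = f(a) = f(b)] the ideal vanishes at [(a, a)] and [(a, b)]. It is therefore proper, and
    the constant representing the Bezoutian would equal both [c] and 0. *)
Lemma constant_Bez_injective f c : c != 0 -> Jac f = c%:MP ->
  (forall q : n.-tuple k, is_constant (reduced_Bez (pm_sub f q))) ->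
  forall a b, (forall j, (tnth f j).@[a] = (tnth f j).@[b]) -> a =1 b.
Proof.
move=> c0 Jf const a b fab i; apply/eqP/negPn/negP => abi.
pose q := [tuple (tnth f j).@[a] | j < n].
set F := pm_sub f q.
have Fa j : (tnth F j).@[a] = 0.
  by rewrite tnth_mktuple mevalB mevalC tnth_mktuple subrr.
have Fb j : (tnth F j).@[b] = 0.
  by rewrite tnth_mktuple mevalB mevalC tnth_mktuple fab subrr.
have kerI p u : (forall l, (tnth (bez_gens F) l).@[u] = 0) -> p \in bez_ideal F -> p.@[u] = 0.
  by move=> u0 pI; apply: (genideal_rmorph0 (phi := meval u) u0).
have uaa l := bez_gens_meval l Fa Fa; have uab l := bez_gens_meval l Fa Fb.
case: (const q) => [[_ [e /eqP]]|[I1 _]]; last first.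
  by have /eqP := kerI _ _ uaa I1; rewrite meval1 oner_eq0.
rewrite -Quotient.idealrBE => BI.
have /eqP := kerI _ _ uaa BI; rewrite mevalB mevalC subr_eq0 Bez_diag Jac_pm_sub Jf mevalC.
have /eqP := kerI _ _ uab BI; rewrite mevalB mevalC subr_eq0 (Bez_eq0 _ abi).
  by move=> /eqP <-; apply/negP.
by move=> j; rewrite Fa Fb.
Qed.

End BezoutianTheory.

(** * Injectivity, invertibility and constancy *)

Lemma injectivity_certificate (k : closedFieldType) (n : nat) (f : n.-tuple {mpoly k[n]}) (c : k) :
  c != 0 -> Jac f = c%:MP ->
  (forall a b, (forall j, (tnth f j).@[a] = (tnth f j).@[b]) -> a =1 b) ->
  exists h : 'I_n -> 'I_n -> {mpoly k[n + n]}, forall i,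
    'X_(lshift n i) - 'X_(rshift n i) =
    \sum_j h i j * (mrename (@lshift n n) k (tnth f j) - mrename (@rshift n n) k (tnth f j)).
Proof.
move=> c0 Jf finj.
pose d j := mrename (@lshift n n) k (tnth f j) - mrename (@rshift n n) k (tnth f j).
(* At a common zero [(a, b)], the differences [d j] force [a = b], where [Bez f] takes the value
   [c]. *)
have [u|s sE] := @weak_nullstellensatz k _ _ (fcons (Bez f) d).
  apply: boolp.contrapT => nou.
  have g0 i : (fcons (Bez f) d i).@[u] = 0.
    by apply/eqP/negPn/negP => gi; apply: nou; exists i.
  pose a i := u (lshift n i); pose b i := u (rshift n i).
  have uE p : p.@[u] = p.@[pairpt a b] by apply: meval_eq => l; rewrite pairptE.
  have ab : a =1 b.
    apply: finj => j; apply/eqP; rewrite -subr_eq0.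
    have := g0 (lift ord0 j); rewrite /fcons liftK uE mevalB.
    by rewrite -comp_xvars -comp_yvars meval_xvars meval_yvars => ->.
  have := g0 ord0; rewrite /fcons unlift_none uE.
  rewrite (@meval_eq _ _ _ (pairpt a a)) => [|l]; last by rewrite /pairpt; case: split.
  by move/eqP; rewrite Bez_diag Jf mevalC (negPf c0).
have [h hE] := Bez_mulB f.
(* These are the coefficients of [1 = s_0 Bez f + \sum_j s_j d_j] times [x_i - y_i], the first term
   being rewritten by [hE]. *)
exists (fun i j => s ord0 * h i j + s (lift ord0 j) * ('X_(lshift n i) - 'X_(rshift n i))) => i.
rewrite -[LHS]mul1r sE big_ord_recl mulrDl /fcons unlift_none -mulrA hE mulr_sumr mulr_suml.
rewrite -big_split; apply: eq_bigr => j _ /=.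
by rewrite liftK comp_xvars comp_yvars -/(d j); ring.
Qed.

Lemma invertible_of_injective (k : closedFieldType) (n : nat) (f : n.-tuple {mpoly k[n]}) (c : k) :
  [pchar k] =i pred0 -> c != 0 -> Jac f = c%:MP ->
  (forall a b, (forall j, (tnth f j).@[a] = (tnth f j).@[b]) -> a =1 b) ->
  pm_invertible f.
Proof.
move=> k0 c0 Jf finj; have [h hE] := injectivity_certificate c0 Jf finj.
have surj := injective_surjective k0 hE.
have /boolp.choice[W WE] i : exists W, mmap (@mpolyC n k) (tnth f) W = 'X_i.
  have [P [Q [Q0 QP]]] := rational_inverse hE i.
  have [|a v l|W PE] := @dvd_along_lines k n P Q.
  - by apply: contraNneq Q0 => ->; rewrite mmap0.
  - exact: dvdp_along_curve c0 Jf surj QP.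
  exists W; apply: (mulfI Q0); rewrite QP PE rmorphM.
  by [].
exists [tuple W i | i < n]; have gf : pm_comp [tuple W i | i < n] f = pm_id k n.
  by apply: eq_from_tnth => i; rewrite !tnth_mktuple -WE.
(* Every [q] is some [f(a)], so [f(g(q)) = f(g(f(a))) = f(a) = q]. *)
split=> //; apply: eq_from_tnth => i; rewrite !tnth_mktuple; apply: mpoly_eval_inj => q.
have [a aq] := surj q; rewrite mevalXU comp_mpoly_meval -aq; apply: meval_eq => j.
rewrite tnth_mktuple (@meval_eq _ _ q (fun i => (tnth f i).@[a])) => [|l]; last by rewrite aq.
by rewrite -comp_mpoly_meval /comp_mpoly WE mevalXU.
Qed.

(** Modulo the ideal, [x_i = g_i(f(x))] and [y_i = g_i(f(y))] both become [p_i = g_i(q)], so each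
    polynomial is congruent to its value at [(p, p)]. The ideal vanishes at that point, hence is
    proper. *)
Lemma invertible_constant_Bez (k : fieldType) (n : nat) (f : n.-tuple {mpoly k[n]}) (q : n.-tuple k) :
  pm_invertible f -> is_constant (reduced_Bez (pm_sub f q)).
Proof.
move=> [g [fg gf]]; set F := pm_sub f q; pose p i := (tnth g i).@[tnth q].
have fp j : (tnth f j).@[p] = tnth q j.
  have := congr1 (fun t => (tnth t j).@[tnth q]) fg.
  by rewrite !tnth_mktuple comp_mpoly_meval mevalXU.
have Fp j : (tnth F j).@[p] = 0 by rewrite tnth_mktuple mevalB mevalC fp subrr.
have up l := bez_gens_meval l Fp Fp.
left; split.
  by apply/negP => /(genideal_rmorph0 (phi := meval (pairpt p p)) up)/eqP; rewrite rmorph1 oner_eq0.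
exists (Bez F).@[pairpt p p]; apply/eqP; rewrite -Quotient.idealrBE.
have genX (s : 'I_n -> 'I_(n + n)) :
    (forall j, mrename s k (tnth f j) - (tnth q j)%:MP \in genideal (bez_gens F)) ->
    forall i, 'X_(s i) - (p i)%:MP \in genideal (bez_gens F).
  move=> sI i; pose phi : {rmorphism {mpoly k[n]} -> {mpoly k[n + n]}} :=
    mrename s k \o comp_mpoly f.
  pose psi : {rmorphism {mpoly k[n]} -> {mpoly k[n + n]}} :=
    @mpolyC (n + n) k \o meval (tnth q).
  have := @genideal_rmorphB _ _ (bez_gens F) n k phi psi (tnth g i).
  have -> : phi (tnth g i) = 'X_(s i).
    have := congr1 (fun t => mrename s k (tnth t i)) gf.
    by rewrite !tnth_mktuple => gfi; rewrite -[LHS]/(mrename s k (tnth g i \mPo f)) gfi /= mmapXU.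
  apply=> [c|j]; first by rewrite /= comp_mpolyC mmapC mevalC.
  by rewrite /= comp_mpolyXU -tnth_nth mevalXU; apply: sI.
apply: (@genideal_rmorphB _ _ (bez_gens F) (n + n) k idfun
  (@mpolyC (n + n) k \o meval (pairpt p p))) => [c|l]; first by rewrite /= mevalC.
rewrite /= mevalXU -[l]splitK; case: (split l) => i /=.
  rewrite pairpt_lshift; apply: genX => j.
  have := genideal_gen (bez_gens F) (lshift n j).
  by rewrite tnth_lshift !tnth_mktuple comp_xvars rmorphB /= mmapC.
rewrite pairpt_rshift; apply: genX => j.
have := genideal_gen (bez_gens F) (rshift n j).
by rewrite tnth_rshift !tnth_mktuple comp_yvars rmorphB /= mmapC.
Qed.

Theorem corollary1p5 (k : closedFieldType) (hk : [pchar k] =i pred0)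
    (n : nat) (f : n.-tuple {mpoly k[n]})
    (hJ : exists2 c : k, c != 0 & Jac f = c%:MP) :
  (forall q : n.-tuple k, is_constant (reduced_Bez (pm_sub f q)))
  <-> pm_invertible f.
Proof.
split=> [const|finv q]; last exact: invertible_constant_Bez.
have [c c0 Jf] := hJ.
exact: invertible_of_injective hk c0 Jf (constant_Bez_injective c0 Jf const).
Qed.
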